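(* Let $p\ge 1$ and $\gamma_1,\beta_1,\dots,\gamma_p,\beta_p\in\mathbb{R}$ be fixed. For even $L$ let $|\psi_L\rangle=e^{-i\beta_pH_1}e^{-i\gamma_pH_2}\cdots e^{-i\beta_1H_1}e^{-i\gamma_1H_2}|0\cdots0\rangle\in(\mathbb{C}^2)^{\otimes L}$. Then in the thermodynamic limit the $X$-magnetization (which is independent of the site $j$) is $$\lim_{L\to\infty}\langle\psi_L|X_j|\psi_L\rangle=1-\frac1\pi\int_{-\pi}^{\pi}\frac{|g_{2p}(k)|^2}{1+|g_{2p}(k)|^2}\,dk .$$
   Context: $X_j,Y_j,Z_j$ are Pauli operators on $(\mathbb{C}^2)^{\otimes L}$, periodic boundary conditions ($Z_{L+1}=Z_1$). $H_1=-\sum_{j=1}^L Z_jZ_{j+1}$, $H_2=-\sum_{j=1}^L X_j$. $Z|0\rangle=|0\rangle$. For $k\in(-\pi,\pi)\setminus\{0\}$ define, with values in the Riemann sphere (right-hand sides read as Möbius transformations), $f_0(k)=0$, $$f_{2j+1}(k)=e^{-4i\gamma_{j+1}}\frac{1-i\tan(k/2)f_{2j}(k)}{f_{2j}(k)-i\tan(k/2)}\ (0\le j\le p-1),\qquad f_{2j}(k)=e^{-4i\beta_j}\frac{1+i\tan(k/2)f_{2j-1}(k)}{f_{2j-1}(k)+i\tan(k/2)}\ (1\le j\le p),$$ and $g_{2p}(k)=\dfrac{1-i\tan(k/2)f_{2p}(k)}{f_{2p}(k)-i\tan(k/2)}$. The ratio $|z|^2/(1+|z|^2)$ is $1$ at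 $z=\infty$. *)

(* Defs.v *)
From HB Require Import structures.
Set Warnings "-notation-overridden,-notation-incompatible-prefix".
From mathcomp Require Import all_boot all_order all_algebra spectral.
From mathcomp Require Import complex.
From mathcomp Require Import all_classical all_reals all_analysis.

Set Implicit Arguments.
Unset Strict Implicit.
Unset Printing Implicit Defensive.

Import Order.TTheory GRing.Theory Num.Theory.
Import numFieldTopology.Exports numFieldNormedType.Exports.

Local Open Scope classical_set_scope.
Local Open Scope ring_scope.
Local Open Scope complex_scope.
Local Open Scope sesquilinear_scope.

(* The complex numbers, packed as an abstract numeric field: the topology used
   below, on C and entrywise on matrices over C, is the one that the library
   attaches to any numFieldType (balls for the modulus). *)
Definition Cplx (R : realType) : numClosedFieldType := R[i].

Section Qubits.
Variable R : realType.
Local Notation C := (Cplx R).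

(* Computational basis of (C^2)^{\otimes L}: 0 labels |0> and 1 labels |1>.
   Basis vectors are numbered by the enumeration of the labels. *)
Definition hdim (L : nat) : nat := #|{ffun 'I_L -> 'I_2}|.

Definition label (L : nat) (s : 'I_(hdim L)) : {ffun 'I_L -> 'I_2} :=
  enum_val s.

(* Entries of A_0 \otimes ... \otimes A_{L-1} and v_0 \otimes ... \otimes
   v_{L-1} in the computational basis. *)
Definition tensor_op (L : nat) (A : 'I_L -> 'M[C]_2) : 'M[C]_(hdim L) :=
  \matrix_(s, t) \prod_(i < L) A i (label s i) (label t i).

Definition tensor_vec (L : nat) (v : 'I_L -> 'cV[C]_2) : 'cV[C]_(hdim L) :=
  \col_s \prod_(i < L) v i (label s i) 0.

Definition pauliX : 'M[C]_2 := \matrix_(a, b) (a != b)%:R.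
Definition pauliZ : 'M[C]_2 := \matrix_(a, b) ((a == b)%:R * (-1) ^+ a).
Definition ket0 : 'cV[C]_2 := \col_a (a == 0)%:R.

Definition at_site (L : nat) (j : 'I_L) (A : 'M[C]_2) : 'M[C]_(hdim L) :=
  tensor_op (fun i => if i == j then A else 1%:M).

(* ordS is the cyclic successor, which gives the periodic boundary. *)
Definition H1 (L : nat) : 'M[C]_(hdim L) :=
  - \sum_(j < L) at_site j pauliZ *m at_site (ordS j) pauliZ.

Definition H2 (L : nat) : 'M[C]_(hdim L) :=
  - \sum_(j < L) at_site j pauliX.

Definition mxexp (n : nat) (A : 'M[C]_n) : 'M[C]_n :=
  limn (series (fun k : nat => (k`!%:R : C)^-1 *: (A ^+ k))).

Definition evol (n : nat) (t : R) (H : 'M[C]_n) : 'M[C]_n :=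
  mxexp ((- ('i * t%:C) : C) *: H).

(* gamma`_j and beta`_j, indexed from 0, are gamma_{j+1} and beta_{j+1}. *)
Fixpoint qaoa_state (L : nat) (gamma beta : seq R) (p : nat) :
    'cV[C]_(hdim L) :=
  if p is j.+1 then
    evol beta`_j (H1 L) *m (evol gamma`_j (H2 L) *m qaoa_state L gamma beta j)
  else tensor_vec (fun _ : 'I_L => ket0).

Definition expval (n : nat) (psi : 'cV[C]_n) (A : 'M[C]_n) : C :=
  (psi ^t* *m A *m psi) 0 0.

End Qubits.

Section Recursion.
Variable R : realType.
Local Notation C := (Cplx R).

(* The Riemann sphere: None is the point at infinity. *)
Definition sphere : Type := option C.

(* z |-> (a z + b) / (c z + d), meant for a d - b c != 0. *)
Definition moebius (a b c d : C) (z : sphere) : sphere :=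
  match z with
  | Some z => if c * z + d == 0 then None else Some ((a * z + b) / (c * z + d))
  | None => if c == 0 then None else Some (a / c)
  end.

Definition expi (theta : R) : C := cos theta +i* sin theta.

Definition itan (k : R) : C := 'i * (tan (k / 2))%:C.

Definition odd_step (theta k : R) : sphere -> sphere :=
  moebius (- (expi theta * itan k)) (expi theta) 1 (- itan k).

Definition even_step (theta k : R) : sphere -> sphere :=
  moebius (expi theta * itan k) (expi theta) 1 (itan k).

(* For n = 2 j and for n = 2 j + 1 the angle that enters f_{n+1} is
   gamma_{j+1}, resp. beta_{j+1}; j = n./2, and it is stored at index j. *)
Fixpoint f_iter (gamma beta : seq R) (n : nat) (k : R) : sphere :=
  if n is m.+1 then
    if odd m then even_step (- 4 * beta`_(m./2)) k (f_iter gamma beta m k)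
    else odd_step (- 4 * gamma`_(m./2)) k (f_iter gamma beta m k)
  else Some 0.

Definition g_iter (gamma beta : seq R) (p : nat) (k : R) : sphere :=
  moebius (- itan k) 1 1 (- itan k) (f_iter gamma beta p.*2 k).

Definition weight (z : sphere) : R :=
  if z is Some z then
    let r := complex.Re `|z| in r ^+ 2 / (1 + r ^+ 2)
  else 1.

End Recursion.

(* Main.v *)
Require Import Defs.
Set Warnings "-notation-overridden,-notation-incompatible-prefix".
From HB Require Import structures.
From mathcomp Require Import all_boot all_order all_algebra spectral.
From mathcomp Require Import complex ring lra zify.
From mathcomp Require Import all_classical all_reals all_analysis.
Set Implicit Arguments.
Unset Strict Implicit.
Unset Printing Implicit Defensive.

Import Order.TTheory GRing.Theory Num.Theory.
Import numFieldTopology.Exports numFieldNormedType.Exports.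

Local Open Scope classical_set_scope.
Local Open Scope ring_scope.
Local Open Scope complex_scope.
Local Open Scope sesquilinear_scope.

(** Conjugation by the QAOA layers acts on the Majorana operators mu_r of the
    Jordan-Wigner transform as a brick-wall circuit of plane rotations, and
    X_j = i mu_{2j} mu_{2j+1}.  The closing bond Z_{L-1} Z_0 is not quadratic in
    the mu_r, but it commutes with every product mu_r mu_s of two bulk operators.
    Since p layers move the index r by O(p) only, for L >= 2 p + 4 and a site at
    distance greater than p from both ends the evolution is exactly that of the
    infinite chain; translation invariance takes care of the other sites.  Hence
    the magnetization is constant for L large.  To evaluate it,
    mu_{2l+2}|0..0> = - i mu_{2l+1}|0..0> and the vectors mu_{2l+1}|0..0> are
    orthonormal, so that it is a Parseval sum; in Fourier space the circuit
    becomes a product of 2 x 2 unitary matrices, whose projective action is the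
    recursion of Moebius transformations, and weight (g_{2p} k) is a squared
    component of the unit spinor at momentum k. *)

(** * Exponentials of sums of commuting involutions *)

Section ComplexExponential.
Variable R : realType.
Local Notation C := (Cplx R).

(** Since [X_j] is a product of two Majorana operators, the magnetization is an inner product of two
    one-particle vectors, and only the real coefficients of these operators have to be followed. The
    coefficients are sequences on [nat], independent of the length of the ring; the length enters
    only through bounds that keep the light cone off the ends. Their Fourier transforms are
    polynomials in z = e^{ik} with continuous k, so orthogonality of exponentials on the circle
    produces the integral directly. The analytic obstacle is [mxexp], a limit of matrices. For a sum
    of commuting involutions a finite list of real numbers and fixed matrices computes all powers,
    so that the limit is taken on scalars and the exponential becomes a finite product of gates cos
    t + i sin t Q. The algebra is written over an arbitrary [numClosedFieldType] with a ring
    morphism [cR] from the reals, which makes explicit what it uses of the complex numbers. *)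

Lemma imagE : ('i%R : C) = 0 +i* 1.
Proof. by rewrite complexiE. Qed.

(** A named embedding with target [Cplx R], so that it carries a ring-morphism structure and can
    instantiate the abstract [cR] of the later sections. *)
Definition cR (x : R) : C := x%:C.

Lemma cR_is_zmod_morphism : zmod_morphism cR.
Proof. by move=> x y; rewrite /cR rmorphB. Qed.

Lemma cR_is_monoid_morphism : monoid_morphism cR.
Proof. by split=> [|x y]; rewrite /cR ?rmorph1 ?rmorphM. Qed.

HB.instance Definition _ := GRing.isZmodMorphism.Build R C cR cR_is_zmod_morphism.
HB.instance Definition _ := GRing.isMonoidMorphism.Build R C cR cR_is_monoid_morphism.

Lemma cplxE (a b : R) : (a +i* b : C) = cR a + 'i * cR b.
Proof. by rewrite imagE /cR; apply/eqP; rewrite eq_complex /= !(mul0r, mul1r, subr0, add0r, addr0) !eqxx. Qed.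

Lemma cvg_complex (u v : nat -> R) (a b : R) :
  u @ \oo --> a -> v @ \oo --> b ->
  (fun n => (u n +i* v n : C)) @ \oo --> (a +i* b : C).
Proof.
move=> ua vb.
have rc (w : nat -> R) (c : R) : w @ \oo --> c ->
    (fun n => cR (w n)) @ \oo --> cR c.
  move=> wc; apply/cvgrPdist_lt => e e0.
  (* A positive element of C is real, so the tolerance can be compared in R. *)
  have re : e = (complex.Re e)%:C.
    by move: e0; case: e => x y; rewrite ltcE /= => /andP[/eqP -> _].
  have e0' : 0 < complex.Re e by move: e0; rewrite {1}re ltcR.
  move/cvgrPdist_lt/(_ _ e0'): wc; apply: filterS => n.
  by rewrite -rmorphB /cR normc_def /= expr0n /= addr0 sqrtr_sqr re ltcR.
rewrite (_ : (fun n => _) = (fun n => cR (u n) + 'i * cR (v n))); last first.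
  by apply/funext => n; rewrite cplxE.
rewrite cplxE; apply: cvgD; first exact: rc.
by apply: cvgM; [exact: cvg_cst | exact: rc].
Qed.

(** Euler's formula on partial sums: i^n is (-1)^(n./2), times i when n is odd, so each term splits
    into the library coefficients of cos and sin. *)
Lemma expi_series (x : R) :
  series (fun k : nat => (k`!%:R : C)^-1 * ('i * cR x) ^+ k) @ \oo --> expi x.
Proof.
rewrite (_ : series _ =
   (fun n => series (cos_coeff x) n +i* series (sin_coeff x) n)).
  apply: cvg_complex.
    by have := @is_cvg_series_cos_coeff _ x; rewrite unlock.
  by have := @is_cvg_series_sin_coeff _ x; rewrite unlock.
apply/funext => n; rewrite !seriesEnat /=.
elim: n => [|n IH]; first by rewrite !big_geq.
rewrite !big_nat_recr //= IH !cplxE.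
suff -> : ((n`!%:R)^-1 * ('i * cR x) ^+ n : C) =
   cR (cos_coeff x n) + 'i * cR (sin_coeff x n).
  by rewrite !rmorphD /=; ring.
rewrite /cos_coeff /sin_coeff exprMn.
have -> : ('i%R ^+ n : C) = (-1) ^+ n./2 * (if odd n then 'i%R else 1).
  rewrite -[in LHS](odd_double_half n) exprD -mul2n exprM sqrCi mulrC.
  by case: (odd n); rewrite ?expr1 ?expr0.
rewrite !(rmorphM, rmorphV, rmorphXn, rmorph_nat, rmorphN1) /=.
- have [on|en] := boolP (odd n) => /=; last by ring.
  have -> : n.-1./2 = n./2 by case: n on {IH} => //= m; rewrite uphalfE /=; lia.
  by ring.
- by rewrite unitfE pnatr_eq0 -lt0n fact_gt0.
- by rewrite unitfE pnatr_eq0 -lt0n fact_gt0.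
Qed.

Lemma expiD (a b : R) : expi (a + b) = expi a * expi b.
Proof.
rewrite /expi cosD sinD; apply/eqP; rewrite eq_complex /=.
by apply/andP; split; apply/eqP; ring.
Qed.

Lemma expi0 : expi (0 : R) = 1.
Proof. by rewrite /expi cos0 sin0. Qed.

Lemma expiN (a : R) : expi (- a) = (expi a)^-1.
Proof.
have h : expi a * expi (- a) = 1 by rewrite -expiD subrr expi0.
have h0 : expi a != 0 by apply: contra_eq_neq h => ->; rewrite mul0r eq_sym oner_eq0.
by apply: (mulfI h0); rewrite h mulfV.
Qed.

Lemma expi_neq0 (a : R) : expi a != 0.
Proof.
have : expi a * expi (- a) = 1 by rewrite -expiD subrr expi0.
by apply: contra_eq_neq => ->; rewrite mul0r eq_sym oner_eq0.
Qed.

Lemma expi_conj (a : R) : (expi a)^* = expi (- a).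
Proof. by rewrite /expi cosN sinN. Qed.

Lemma conj_real (a : R) : (cR a)^* = cR a.
Proof. by rewrite /cR; apply/eqP; rewrite eq_complex /= oppr0 !eqxx. Qed.

Lemma expiE (a : R) : expi a = cR (cos a) + 'i * cR (sin a).
Proof. exact: cplxE. Qed.

End ComplexExponential.

Lemma cvg_sum_scaler (K : numFieldType) (V : normedModType K) (T : Type)
    (f : T -> nat -> K) (l : T -> K) (s : seq (T * V)) :
    (forall x, f x @ \oo --> l x) ->
  (fun N => \sum_(x <- s) f x.1 N *: x.2) @ \oo --> \sum_(x <- s) l x.1 *: x.2.
Proof.
move=> fl; elim: s => [|x s IH].
  by under eq_fun do rewrite big_nil; rewrite big_nil; exact: cvg_cst.
under eq_fun do rewrite big_cons.
by rewrite big_cons; apply: cvgD IH; apply: cvgZr_tmp; exact: fl.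
Qed.

Lemma sum_cat_map (V : nmodType) (S T : Type) (f g : S -> T) (s : seq S) (F : T -> V) :
  \sum_(x <- [seq f x | x <- s] ++ [seq g x | x <- s]) F x =
  \sum_(x <- s) F (f x) + \sum_(x <- s) F (g x).
Proof. by rewrite big_cat !big_map. Qed.

Section Spectral.
Variables (R : realType) (C : numClosedFieldType) (cR : {rmorphism R -> C}) (n : nat).
Implicit Types (A E : 'M[C]_n) (s : seq (R * 'M[C]_n)).

(* A^k = sum_i lambda_i^k E_i for all k, so that every power series in A is
   computed on the real numbers lambda_i. *)
Definition spectral_family A s :=
  forall k, A ^+ k = \sum_(x <- s) (cR x.1 ^+ k) *: x.2 :> 'M[C]_n.

(** e^{ix} over the abstract field; over [Cplx R] it is [expi]. *)
Definition cis (x : R) : C := cR (cos x) + 'i * cR (sin x).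

Lemma cis0 : cis 0 = 1.
Proof. by rewrite /cis cos0 sin0 rmorph0 rmorph1 mulr0 addr0. Qed.

Lemma cisD (a b : R) : cis (a + b) = cis a * cis b.
Proof.
have i2 : ('i * 'i : C) = -1 by rewrite -expr2 sqrCi.
by rewrite /cis cosD sinD !(rmorphD, rmorphB, rmorphM) /=; ring: i2.
Qed.

Definition spectral_evol (t : R) s : 'M[C]_n :=
  \sum_(x <- s) cis (- (t * x.1)) *: x.2.

Lemma exp_term (t : R) A s k : spectral_family A s ->
  (k`!%:R : C)^-1 *: ((- ('i * cR t) : C) *: A) ^+ k =
  \sum_(x <- s) ((k`!%:R : C)^-1 * ('i * cR (- (t * x.1))) ^+ k) *: x.2.
Proof.
move=> sA.
have -> : (- ('i * cR t) *: A) ^+ k = ((- ('i * cR t)) ^+ k) *: A ^+ k.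
  elim: k => [|k IH]; first by rewrite !expr0 scale1r.
  by rewrite !exprS IH -!mulmxE -scalemxAl -scalemxAr scalerA.
rewrite scalerA.
rewrite sA.
rewrite scaler_sumr.
apply: eq_bigr => x _.
rewrite scalerA.
congr (_ *: _).
by rewrite rmorphN rmorphM /= mulrN mulrA -mulNr -mulrA -exprMn mulNr.
Qed.

(** By the binomial theorem, adding a scalar shifts the numbers of a family and keeps its
    matrices. *)
Lemma spectral_family_shift A s (c : R) :
  spectral_family A s ->
  forall k, (A + (cR c)%:M) ^+ k =
     \sum_(x <- s) (cR (x.1 + c) ^+ k) *: x.2 :> 'M[C]_n.
Proof.
move=> sA k; rewrite addrC exprDn_comm; last first.
  by rewrite /GRing.comm -!mulmxE scalar_mxC.
transitivity (\sum_(i < k.+1) \sum_(x <- s)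
    ((cR c ^+ (k - i) * cR x.1 ^+ i) *+ 'C(k, i)) *: x.2).
  apply: eq_bigr => i _; rewrite sA.
  have -> m : (cR c)%:M ^+ m = (cR c ^+ m)%:M :> 'M[C]_n.
    elim: m => [|m IH]; first by rewrite !expr0.
    by rewrite !exprS IH -mulmxE -scalar_mxM.
  rewrite -mulmxE mul_scalar_mx scaler_sumr -sumrMnl.
  by apply: eq_bigr => x _; rewrite scalerA scalerMnl.
rewrite exchange_big; apply: eq_bigr => x _ /=.
by rewrite -scaler_suml -exprDn rmorphD /= addrC.
Qed.

(** This is e^{itQ} for an involution Q; the sign is that of e^{-itH} with H a sum of terms -Q. *)
Definition gate (t : R) (Q : 'M[C]_n) : 'M[C]_n :=
  (cR (cos t))%:M + ('i * cR (sin t)) *: Q.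

(** The projections (1 + Q)/2 and (1 - Q)/2 commute with A, and on their images A - Q acts as A - 1
    and A + 1. Each member of the family splits in two, and the phases e^{it}, e^{-it} on the two
    halves recombine into [gate t Q]. *)
Lemma spectral_familyB A s (Q : 'M[C]_n) (t : R) :
    Q *m Q = 1%:M -> Q *m A = A *m Q -> spectral_family A s ->
  exists s', spectral_family (A - Q) s' /\
    spectral_evol t s' = spectral_evol t s *m gate t Q.
Proof.
move=> QQ QA sA.
pose p (b : bool) : 'M[C]_n := (2%:R^-1 : C) *: (1%:M - ((-1) ^+ b : C) *: Q).
pose f (b : bool) (x : R * 'M[C]_n) := (x.1 + (-1) ^+ b, x.2 *m p b).
exists ([seq f true x | x <- s] ++ [seq f false x | x <- s]).
have pQ (b : bool) : p b *m Q = - ((-1) ^+ b : C) *: p b.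
  rewrite /p -scalemxAl mulmxBl mul1mx -scalemxAl QQ scalerA [_ * _^-1]mulrC.
  rewrite -scalerA; congr (_ *: _).
  rewrite scalerBr scalerA mulNr -expr2 sqrr_sign scaleN1r scaleNr opprK.
  by rewrite addrC.
have pA (b : bool) : p b *m A = A *m p b.
  rewrite /p -scalemxAl -scalemxAr mulmxBl mulmxBr mul1mx mulmx1.
  by rewrite -scalemxAl -scalemxAr QA.
have p1 : p true + p false = 1%:M.
  rewrite /p -scalerDr expr1 expr0 scale1r scaleN1r opprK addrACA subrr addr0.
  by apply/matrixP => i j; rewrite !mxE; field.
split.
  move=> k; rewrite sum_cat_map.
  have pE (b : bool) : \sum_(x <- s) (cR (f b x).1 ^+ k) *: (f b x).2 =
     (A + (cR ((-1) ^+ b))%:M) ^+ k *m p b.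
    rewrite (spectral_family_shift _ sA) mulmx_suml.
    by apply: eq_bigr => x _; rewrite scalemxAl.
  rewrite (pE true) (pE false).
  elim: k {pE} => [|k IH].
    by rewrite !expr0 !mulmxE !mul1r; exact: esym p1.
  rewrite exprSr -mulmxE IH mulmxDl -!mulmxA; congr (_ + _);
  rewrite exprSr -mulmxE -mulmxA; congr (_ *m _);
  rewrite mulmxBr pA pQ mulmxDl mul_scalar_mx scaleNr opprK;
  by rewrite rmorph_sign.
rewrite /spectral_evol sum_cat_map.
have pE (b : bool) : \sum_(x <- s) cis (- (t * (f b x).1)) *: (f b x).2 =
   (\sum_(x <- s) cis (- (t * x.1)) *: x.2) *m
     (cis (- (t * (-1) ^+ b)) *: p b).
  rewrite mulmx_suml; apply: eq_bigr => x _.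
  by rewrite mulrDr opprD cisD -scalemxAl -scalemxAr scalerA.
rewrite (pE true) (pE false) -mulmxDr; congr (_ *m _).
rewrite /p expr1 expr0 mulrN1 mulr1 opprK !scalerA !scale1r scaleN1r opprK.
rewrite /gate /cis cosN sinN rmorphN /= !scalerDr scalerN.
rewrite addrACA -scalerDl -scalerBl scalemx1.
have h2 : (2%:R : C) != 0 by rewrite pnatr_eq0.
by congr (_%:M + _ *: _); field.
Qed.

Definition gates t (Qs : seq 'M[C]_n) : 'M[C]_n :=
  foldl (fun U Q => U *m gate t Q) 1%:M Qs.

Lemma spectral_gates (t : R) (I : Type) (r : seq I) (Q : I -> 'M[C]_n) :
  (forall i, Q i *m Q i = 1%:M) -> (forall i j, Q i *m Q j = Q j *m Q i) ->
  exists s, spectral_family (- \sum_(i <- r) Q i) s /\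
   spectral_evol t s = gates t [seq Q i | i <- r].
Proof.
move=> QQ QC.
elim/last_ind: r => [|r i [s [h1 h2]]].
  (* The zero matrix has the one-member family (0, 1), because 0^0 = 1. *)
  exists [:: (0, 1%:M)]; split=> [k|].
    rewrite big_nil oppr0 big_seq1 /= rmorph0.
    by case: k => [|k]; rewrite ?expr0 ?scale1r // !exprS !mul0r scale0r.
  by rewrite /spectral_evol big_seq1 /= mulr0 oppr0 cis0 scale1r.
have [|s' [h3 h4]] := spectral_familyB t (QQ i) _ h1.
  by rewrite mulmxN mulNmx mulmx_sumr mulmx_suml; congr (- _); apply: eq_bigr.
exists s'; rewrite -cats1 big_cat /= big_seq1 opprD map_cat /gates foldl_cat /= h4 h2.
by split.
Qed.

End Spectral.

Lemma evolE (R : realType) (n : nat) (t : R) (H : 'M[Cplx R]_n) :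
  evol t H = mxexp (- ('i * cR t : Cplx R) *: H).
Proof. by []. Qed.

Section EvolSpectral.
Variables (R : realType) (n : nat).
Local Notation C := (Cplx R).

(** The only place where the limit in [mxexp] is computed: each partial sum combines the fixed
    matrices of the family with partial sums of scalar exponential series. *)
Lemma evol_spectral (t : R) (A : 'M[C]_n) s :
  spectral_family (@cR R) A s -> evol t A = spectral_evol (@cR R) t s.
Proof.
move=> sA; rewrite evolE; apply: cvg_lim; first exact: norm_hausdorff.
rewrite (_ : series _ = (fun N => \sum_(x <- s)
   (series (fun k : nat => (k`!%:R : C)^-1 * ('i * cR (- (t * x.1))) ^+ k) N) *: x.2)).
  rewrite /spectral_evol.
  have h := (@cvg_sum_scaler C 'M[C]_n R
    (fun x => series (fun k : nat => (k`!%:R : C)^-1 * ('i * cR (- (t * x))) ^+ k))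
    (fun x => cis (@cR R) (- (t * x))) s _).
  apply: h => x; rewrite /cis -expiE; exact: expi_series.
apply/funext => N; rewrite !seriesEnat /=.
under [RHS]eq_bigr do rewrite seriesEnat /= scaler_suml.
rewrite exchange_big /=; apply: eq_bigr => k _.
exact: (exp_term (cR := @cR R)).
Qed.


Lemma evol_gates (t : R) (I : Type) (r : seq I) (Q : I -> 'M[C]_n) :
  (forall i, Q i *m Q i = 1%:M) -> (forall i j, Q i *m Q j = Q j *m Q i) ->
  evol t (- \sum_(i <- r) Q i) = gates (@cR R) t [seq Q i | i <- r].
Proof.
move=> QQ QC; have [s [h1 <-]] := spectral_gates (@cR R) t r QQ QC.
exact: evol_spectral.
Qed.

End EvolSpectral.

(** * Operators on sites *)

Section Commutation.
Variables (C : numClosedFieldType) (n : nat).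
Implicit Types A B D : 'M[C]_n.

Lemma mulmx_comm2 A B D : A *m B = B *m A -> A *m D = D *m A ->
  A *m (B *m D) = B *m D *m A.
Proof. by move=> AB AD; rewrite mulmxA AB -mulmxA AD mulmxA. Qed.

Lemma mulmx_scale_comm A B D (s t : C) :
  A *m B = s *: (B *m A) -> A *m D = t *: (D *m A) ->
  A *m (B *m D) = (s * t) *: (B *m D *m A).
Proof.
by move=> AB AD; rewrite mulmxA AB -scalemxAl -mulmxA AD -scalemxAr scalerA mulmxA.
Qed.

End Commutation.

Section Adjoint.
Variable C : numClosedFieldType.

Lemma adj_mul m n p (A : 'M[C]_(m, n)) (B : 'M[C]_(n, p)) :
  (A *m B) ^t* = B ^t* *m A ^t*.
Proof. by rewrite trmx_mul map_mxM. Qed.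

Lemma adj_add m n (A B : 'M[C]_(m, n)) : (A + B) ^t* = A ^t* + B ^t*.
Proof. by rewrite linearD /= map_mxD. Qed.

Lemma adj_scale m n (c : C) (A : 'M[C]_(m, n)) : (c *: A) ^t* = c^* *: A ^t*.
Proof. by rewrite linearZ /= map_mxZ. Qed.

Lemma adj_scalar n (c : C) : ((c%:M : 'M[C]_n) ^t*) = (c^*)%:M.
Proof. by rewrite tr_scalar_mx map_scalar_mx. Qed.

Lemma adj_sum m n (I : Type) (r : seq I) (F : I -> 'M[C]_(m, n)) :
  (\sum_(i <- r) F i) ^t* = \sum_(i <- r) (F i) ^t*.
Proof.
elim: r => [|i r IH]; last by rewrite !big_cons adj_add IH.
by rewrite !big_nil linear0 map_mx0.
Qed.

End Adjoint.

Section Sites.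
Variable R : realType.
Local Notation C := (Cplx R).
Variable L : nat.

Lemma sum_labels (V : nmodType) (F : {ffun 'I_L -> 'I_2} -> V) :
  \sum_(s < hdim L) F (label s) = \sum_f F f.
Proof. by rewrite -(big_enum_val F). Qed.

Lemma tensor_opM (A B : 'I_L -> 'M[C]_2) :
  tensor_op A *m tensor_op B = tensor_op (fun i => A i *m B i).
Proof.
apply/matrixP => s t; rewrite !mxE.
under eq_bigr do rewrite !mxE -big_split /=.
rewrite (sum_labels (fun f => \prod_(i < L) (A i (label s i) (f i) * B i (f i) (label t i)))).
by rewrite -(bigA_distr_bigA (fun i j => A i (label s i) j * B i j (label t i)));
  apply: eq_bigr => i _; rewrite mxE.
Qed.

Lemma tensor_op_vec (A : 'I_L -> 'M[C]_2) (v : 'I_L -> 'cV[C]_2) :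
  tensor_op A *m tensor_vec v = tensor_vec (fun i => A i *m v i).
Proof.
apply/matrixP => s t; rewrite !mxE.
under eq_bigr do rewrite !mxE -big_split /=.
rewrite (sum_labels (fun f => \prod_(i < L) (A i (label s i) (f i) * v i (f i) 0))).
by rewrite -(bigA_distr_bigA (fun i j => A i (label s i) j * v i j 0));
  apply: eq_bigr => i _; rewrite mxE.
Qed.

Lemma tensor_op1 : tensor_op (fun _ : 'I_L => 1%:M : 'M[C]_2) = 1%:M.
Proof.
apply/matrixP => s t; rewrite !mxE.
have [->|st] := eqVneq s t; first by rewrite big1 // => i _; rewrite mxE eqxx.
have /eqP : label s != label t by apply: contra st => /eqP /enum_val_inj ->.
move=> ne; have [/existsP[i hi]|] := boolP [exists i, label s i != label t i].
  by rewrite (bigD1 i) //= mxE (negbTE hi) mul0r.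
by rewrite negb_exists => /forallP h; case: ne; apply/ffunP => i; apply/eqP; rewrite -[_ == _]negbK.
Qed.

Lemma tensor_op_adj (A : 'I_L -> 'M[C]_2) :
  (tensor_op A) ^t* = tensor_op (fun i => (A i) ^t*).
Proof.
apply/matrixP => s t; rewrite !mxE rmorph_prod /=.
by apply: eq_bigr => i _; rewrite !mxE.
Qed.

Lemma eq_tensor_op (A B : 'I_L -> 'M[C]_2) : A =1 B -> tensor_op A = tensor_op B.
Proof. by move=> AB; apply/matrixP => s t; rewrite !mxE; apply: eq_bigr => i _; rewrite AB. Qed.

Lemma at_siteM (j : 'I_L) (A B : 'M[C]_2) :
  at_site j A *m at_site j B = at_site j (A *m B).
Proof. by rewrite tensor_opM; apply: eq_tensor_op => i; case: eqP => // _; rewrite mulmx1. Qed.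

Lemma at_site_comm (j k : 'I_L) (A B : 'M[C]_2) : j != k ->
  at_site j A *m at_site k B = at_site k B *m at_site j A.
Proof.
move=> jk; rewrite !tensor_opM; apply: eq_tensor_op => i.
have [->|] := eqVneq i j; first by rewrite (negbTE jk) mulmx1 mul1mx.
by rewrite mul1mx mulmx1.
Qed.

Lemma at_site1 (j : 'I_L) : at_site j (1%:M : 'M[C]_2) = 1%:M.
Proof. by rewrite -tensor_op1; apply: eq_tensor_op => i; case: ifP. Qed.

Lemma at_siteN (j : 'I_L) (A : 'M[C]_2) : at_site j (- A) = - at_site j A.
Proof.
apply/matrixP => s t; rewrite !mxE (bigD1 j) //= [in RHS](bigD1 j) //= eqxx mxE mulNr.
by congr (- (_ * _)); apply: eq_bigr => i /negbTE ->.
Qed.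

Lemma at_site_adj (j : 'I_L) (A : 'M[C]_2) : (at_site j A) ^t* = at_site j (A ^t*).
Proof.
rewrite tensor_op_adj; apply: eq_tensor_op => i; case: eqP => // _.
by rewrite adj_scalar rmorph1.
Qed.

Lemma at_site_stab (j : 'I_L) (A : 'M[C]_2) (v : 'cV[C]_2) : A *m v = v ->
  at_site j A *m tensor_vec (fun=> v) = tensor_vec (fun=> v).
Proof.
move=> Av; rewrite tensor_op_vec; apply/matrixP => s t; rewrite !mxE.
by apply: eq_bigr => i _; case: eqP => _; rewrite ?mul1mx ?Av.
Qed.

Lemma tensor_vec_norm (v : 'cV[C]_2) : v ^t* *m v = 1%:M ->
  (tensor_vec (fun _ : 'I_L => v)) ^t* *m tensor_vec (fun _ : 'I_L => v) = 1%:M.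
Proof.
move=> vv; apply/matrixP => a b; rewrite !ord1 [RHS]mxE eqxx mxE.
under eq_bigr do rewrite !mxE rmorph_prod -big_split /=.
rewrite (sum_labels (fun f => \prod_(i < L) ((v (f i) 0)^* * v (f i) 0))).
rewrite -(bigA_distr_bigA (fun i j => (v j 0)^* * v j 0)) big1 // => i _.
move/matrixP/(_ 0 0): vv; rewrite !mxE; apply: etrans.
by apply: eq_bigr => k _; rewrite !mxE.
Qed.

End Sites.

Section Pauli.
Variable R : realType.
Local Notation C := (Cplx R).

Lemma pauliXX : pauliX R *m pauliX R = 1%:M.
Proof.
apply/matrixP => -[[|[|]]//= ?] -[[|[|]]//= ?];
by rewrite !mxE !big_ord_recl big_ord0 !mxE /=; ring.
Qed.

Lemma pauliZZ : pauliZ R *m pauliZ R = 1%:M.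
Proof.
apply/matrixP => -[[|[|]]//= ?] -[[|[|]]//= ?];
by rewrite !mxE !big_ord_recl big_ord0 !mxE /=; ring.
Qed.

Lemma pauliXZ : pauliX R *m pauliZ R = - (pauliZ R *m pauliX R).
Proof.
apply/matrixP => -[[|[|]]//= ?] -[[|[|]]//= ?];
by rewrite !mxE !big_ord_recl !big_ord0 !mxE /=; ring.
Qed.

Lemma pauliX_adj : (pauliX R) ^t* = pauliX R.
Proof. by apply/matrixP => a b; rewrite !mxE eq_sym rmorph_nat. Qed.

Lemma pauliZ_adj : (pauliZ R) ^t* = pauliZ R.
Proof.
apply/matrixP => a b; rewrite !mxE eq_sym rmorphM rmorph_nat rmorph_sign /=.
by case: eqP => [->|_] //; rewrite !mul0r.
Qed.

Lemma pauliZ_ket0 : pauliZ R *m ket0 R = ket0 R.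
Proof.
apply/matrixP => -[[|[|]]//= ?] b;
by rewrite !mxE !big_ord_recl !big_ord0 !mxE /=; ring.
Qed.

Lemma ket0_norm : (ket0 R) ^t* *m ket0 R = 1%:M.
Proof.
apply/matrixP => a b; rewrite !ord1 !mxE !big_ord_recl !big_ord0 !mxE /=.
by rewrite !rmorph_nat /=; ring.
Qed.

End Pauli.

(** * Majorana operators and their evolution *)

Section Coefficients.
Variables (R : realType) (C : numClosedFieldType) (cR : {rmorphism R -> C}).

(* The pair (a, b) stands for sum_l a_l mu_{2l} + b_l mu_{2l+1}. *)
Definition coefs : Type := (nat -> R) * (nat -> R).
Implicit Types c : coefs.

(** The module is arbitrary because the same identities serve matrices, for the Majorana operators,
    and scalars, for the pairing in Fourier space. *)
Definition comb (V : lmodType C) (N : nat) (fe fo : nat -> V) c : V :=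
  \sum_(l < N.+1) (cR (c.1 l) *: fe l + cR (c.2 l) *: fo l).

Definition rotX (t : R) c : coefs :=
  (fun l => cos (2 * t) * c.1 l + sin (2 * t) * c.2 l,
   fun l => cos (2 * t) * c.2 l - sin (2 * t) * c.1 l).

(** The planes rotated here are those of mu_{2l+1} and mu_{2l+2}, across a bond. Site 0 has no left
    neighbour, and the missing coefficient is set to 0. *)
Definition rotZZ (t : R) c : coefs :=
  (fun l => cos (2 * t) * c.1 l - sin (2 * t) * (if l is l'.+1 then c.2 l' else 0),
   fun l => cos (2 * t) * c.2 l + sin (2 * t) * c.1 l.+1).

Lemma scale_rot (V : lmodType C) (x y p q : C) (u v : V) :
  (x * p + y * q) *: u + (x * q - y * p) *: v =
  p *: (x *: u - y *: v) + q *: (x *: v + y *: u).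
Proof.
rewrite !scalerDr !scalerN !scalerA !scalerDl scaleNr.
rewrite [p * x]mulrC [p * y]mulrC [q * x]mulrC [q * y]mulrC.
by rewrite addrACA [RHS]addrACA; congr (_ + _); rewrite addrC.
Qed.

Lemma comb_rotX (V : lmodType C) N (fe fo : nat -> V) t c :
  comb N fe fo (rotX t c) =
  comb N (fun l => cR (cos (2 * t)) *: fe l - cR (sin (2 * t)) *: fo l)
         (fun l => cR (cos (2 * t)) *: fo l + cR (sin (2 * t)) *: fe l) c.
Proof.
apply: eq_bigr => l _; rewrite /= !(rmorphD, rmorphN, rmorphM) /=.
exact: scale_rot.
Qed.

(** Regroups the sum by bonds instead of sites; the two end terms, which belong to no bond of the
    open chain, vanish. *)
Lemma comb_shift (V : lmodType C) N (fe fo : nat -> V) c :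
    c.1 0%N = 0 -> c.2 N = 0 ->
  comb N fe fo c = \sum_(l < N) (cR (c.1 l.+1) *: fe l.+1 + cR (c.2 l) *: fo l).
Proof.
move=> c0 cN; rewrite /comb !big_split /=; congr (_ + _).
  by rewrite big_ord_recl /= c0 rmorph0 scale0r add0r.
by rewrite big_ord_recr /= cN rmorph0 scale0r addr0.
Qed.

(** The condition on [c.1 N.+1] keeps the rotation from bringing into site N a coefficient that the
    sum does not contain. *)
Lemma comb_rotZZ (V : lmodType C) N (fe fo fe' fo' : nat -> V) t c :
    c.1 0%N = 0 -> c.1 N.+1 = 0 -> c.2 N = 0 ->
    (forall l, (l < N)%N ->
       fe' l.+1 = cR (cos (2 * t)) *: fe l.+1 + cR (sin (2 * t)) *: fo l) ->
    (forall l, (l < N)%N ->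
       fo' l = cR (cos (2 * t)) *: fo l - cR (sin (2 * t)) *: fe l.+1) ->
  comb N fe fo (rotZZ t c) = comb N fe' fo' c.
Proof.
move=> c0 c1 c2 he ho.
have r0 : (rotZZ t c).1 0%N = 0 by rewrite /= c0 !mulr0 subr0.
have rN : (rotZZ t c).2 N = 0 by rewrite /= c1 c2 !mulr0 addr0.
rewrite !comb_shift //.
apply: eq_bigr => -[l lN] _ /=; rewrite he // ho // !(rmorphD, rmorphN, rmorphM) /=.
by rewrite addrC [RHS]addrC scale_rot.
Qed.

Definition supported (lo hi : nat) c :=
  forall l, (l < lo)%N || (hi < l)%N -> c.1 l = 0 /\ c.2 l = 0.

Lemma supported_rotX t lo hi c : supported lo hi c -> supported lo hi (rotX t c).
Proof. by move=> sc l /sc[h1 h2]; rewrite /= h1 h2 !mulr0 addr0 subr0. Qed.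

(** The light cone: a ZZ layer spreads the support by one site on each side, while an X layer acts
    within the sites. *)
Lemma supported_rotZZ t lo hi c :
  supported lo.+1 hi c -> supported lo hi.+1 (rotZZ t c).
Proof.
move=> sc l ll; rewrite /=; have [|-> ->] := sc l; first by lia.
split; last by have [|-> _] := sc l.+1; [lia | rewrite !mulr0 addr0].
rewrite mulr0 sub0r; case: l ll => [|l] ll; first by rewrite mulr0 oppr0.
by have [|_ ->] := sc l; [lia | rewrite mulr0 oppr0].
Qed.

End Coefficients.

(** * Conjugation by gates *)

Section Gates.
Variables (R : realType) (C : numClosedFieldType) (cR : {rmorphism R -> C}) (n : nat).
Hypothesis conj_cR : forall x, (cR x)^*%R = cR x.
Implicit Types (Q U A B : 'M[C]_n).

Definition hconj U A : 'M[C]_n := U ^t* *m A *m U.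

Lemma hconj_mull U V A : hconj (U *m V) A = hconj V (hconj U A).
Proof. by rewrite /hconj adj_mul !mulmxA. Qed.

Lemma hconj1 A : hconj 1%:M A = A.
Proof. by rewrite /hconj adj_scalar rmorph1 mul1mx mulmx1. Qed.

Lemma hconjD U A B : hconj U (A + B) = hconj U A + hconj U B.
Proof. by rewrite /hconj mulmxDr mulmxDl. Qed.

Lemma hconjZ U (c : C) A : hconj U (c *: A) = c *: hconj U A.
Proof. by rewrite /hconj -scalemxAr -scalemxAl. Qed.

Lemma hconj_sum U (I : Type) (r : seq I) (F : I -> 'M[C]_n) :
  hconj U (\sum_(i <- r) F i) = \sum_(i <- r) hconj U (F i).
Proof. by rewrite /hconj mulmx_sumr mulmx_suml. Qed.

Lemma hconjM U A B : U *m U ^t* = 1%:M ->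
  hconj U (A *m B) = hconj U A *m hconj U B.
Proof.
move=> UU; rewrite /hconj !mulmxA; congr (_ *m _ *m _).
by rewrite -[RHS]mulmxA UU mulmx1.
Qed.

Definition hinvol Q := Q *m Q = 1%:M /\ Q ^t* = Q.

Lemma gate0 Q : gate cR 0 Q = 1%:M.
Proof. by rewrite /gate cos0 sin0 rmorph0 rmorph1 mulr0 scale0r addr0. Qed.

Lemma gateD s t Q : hinvol Q -> gate cR s Q *m gate cR t Q = gate cR (s + t) Q.
Proof.
move=> [QQ _]; rewrite /gate mulmxDl !mulmxDr -!scalemxAr -!scalemxAl QQ.
rewrite -scalar_mxM mul_scalar_mx mul_mx_scalar !scalerA cosD sinD.
have i2 : ('i * 'i : C) = -1 by rewrite -expr2 sqrCi.
apply/matrixP => i j; rewrite !mxE !(rmorphD, rmorphB, rmorphM) /=.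
by case: (i == j); rewrite /= ?mulr1n ?mulr0n; ring: i2.
Qed.

Lemma gate_adj t Q : hinvol Q -> (gate cR t Q) ^t* = gate cR (- t) Q.
Proof.
move=> [_ Qh]; rewrite /gate adj_add adj_scalar adj_scale Qh cosN sinN.
by rewrite rmorphM rmorphN /= !conj_cR conjCi mulrN mulNr.
Qed.

Lemma gate_unitary t Q : hinvol Q -> gate cR t Q *m (gate cR t Q) ^t* = 1%:M.
Proof. by move=> hQ; rewrite gate_adj // gateD // subrr gate0. Qed.

Lemma gate_unitaryl t Q : hinvol Q -> (gate cR t Q) ^t* *m gate cR t Q = 1%:M.
Proof. by move=> hQ; rewrite gate_adj // gateD // addNr gate0. Qed.

Lemma hconj_gate_comm t Q A : hinvol Q -> A *m Q = Q *m A -> hconj (gate cR t Q) A = A.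
Proof.
move=> hQ AQ; rewrite /hconj.
have -> : (gate cR t Q) ^t* *m A = A *m (gate cR t Q) ^t*.
  rewrite gate_adj // /gate mulmxDl mulmxDr -scalemxAl -scalemxAr AQ.
  by rewrite mul_scalar_mx mul_mx_scalar.
by rewrite -mulmxA gate_unitaryl // mulmx1.
Qed.

(** Moving A through the adjoint gate inverts it, so the conjugate is A times the square of the
    gate; hence the angle 2t. *)
Lemma hconj_gate_anti t Q A : hinvol Q -> A *m Q = - (Q *m A) ->
  hconj (gate cR t Q) A = cR (cos (2 * t)) *: A + ('i * cR (sin (2 * t))) *: (A *m Q).
Proof.
move=> hQ AQ; rewrite /hconj.
have -> : (gate cR t Q) ^t* *m A = A *m gate cR t Q.
  rewrite gate_adj // /gate mulmxDl mulmxDr -scalemxAl -scalemxAr AQ.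
  rewrite mul_scalar_mx mul_mx_scalar cosN sinN rmorphN /= mulrN scaleNr.
  by rewrite scalerN.
rewrite -mulmxA gateD // [2 * t]mulr_natl mulr2n /gate mulmxDr mul_mx_scalar.
by rewrite -scalemxAr.
Qed.

Lemma gates_rcons t Qs Q : gates cR t (rcons Qs Q) = gates cR t Qs *m gate cR t Q.
Proof. by rewrite /gates -cats1 foldl_cat. Qed.

Lemma gates_unitary t Qs : (forall Q, Q \in Qs -> hinvol Q) ->
  gates cR t Qs *m (gates cR t Qs) ^t* = 1%:M.
Proof.
elim/last_ind: Qs => [|Qs Q IH] h; first by rewrite /= adj_scalar rmorph1 mul1mx.
rewrite gates_rcons adj_mul mulmxA -[_ *m gate cR t Q *m _]mulmxA gate_unitary.
  by rewrite mulmx1 IH // => P PQs; apply: h; rewrite mem_rcons inE PQs orbT.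
by apply: h; rewrite mem_rcons mem_head.
Qed.

End Gates.

(** * The algebra of Majorana strings *)

Section Clifford.
Variables (R : realType) (C : numClosedFieldType) (cR : {rmorphism R -> C}) (n : nat).
Hypothesis conj_cR : forall x, (cR x)^*%R = cR x.
(* On the chain, Q_{2l} = X_l and Q_{2l+1} = Z_l Z_{l+1} for indices below K,
   m0 = Z_0, and Qb is the bond that closes the ring. *)
Variables (Q : nat -> 'M[C]_n) (m0 Qb : 'M[C]_n) (K : nat).

Definition adjacent (r s : nat) : bool := (s == r.+1) || (s.+1 == r).

(* Z_0, Y_0, X_0 Z_1, X_0 Y_1, X_0 X_1 Z_2, ... *)
Fixpoint mu_rec (r : nat) : 'M[C]_n :=
  if r is r'.+1 then (- 'i : C) *: (mu_rec r' *m Q r') else m0.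

(* Locked, lest unification unfold mu r.+1 into a scaled product. *)
Definition mu : nat -> 'M[C]_n := locked mu_rec.

Lemma mu0 : mu 0 = m0.
Proof. by rewrite /mu -lock. Qed.

Lemma muS r : mu r.+1 = (- 'i : C) *: (mu r *m Q r).
Proof. by rewrite /mu -lock. Qed.

Hypothesis Q_hinvol : forall r, (r < K)%N -> hinvol (Q r).
Hypothesis Q_comm : forall r s, (r < K)%N -> (s < K)%N ->
  Q r *m Q s = ((-1) ^+ adjacent r s : C) *: (Q s *m Q r).
Hypothesis m0_hinvol : hinvol m0.
Hypothesis m0_Q : forall s, (s < K)%N -> m0 *m Q s = ((-1) ^+ (s == 0%N) : C) *: (Q s *m m0).
Hypothesis Qb_hinvol : hinvol Qb.
Hypothesis Qb_m0 : m0 *m Qb = Qb *m m0.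
Hypothesis Qb_Q : forall s, (s.+1 < K)%N -> Q s *m Qb = ((-1) ^+ (s == 0%N) : C) *: (Qb *m Q s).

(** Up to a phase mu_r is the string m0 Q_0 ... Q_{r-1}. The signs from Q_{s-1} (or m0 when s = 0)
    and Q_{s+1} cancel when both are in the string, so a sign survives only if the string stops
    right before or right after Q_s. *)
Lemma mu_Q r s : (r <= K)%N -> (s < K)%N ->
  mu r *m Q s = ((-1) ^+ ((s == r) || (s.+1 == r)) : C) *: (Q s *m mu r).
Proof.
move=> + sK; elim: r => [|r IH] rK; first by rewrite mu0 orbF; exact: m0_Q.
rewrite muS -scalemxAl -mulmxA Q_comm // -!scalemxAr mulmxA IH ?(ltnW rK) //.
rewrite -scalemxAl mulmxA !scalerA; congr (_ *: _).
have -> : (s == r.+1) || (s.+1 == r.+1) = adjacent r s (+) ((s == r) || (s.+1 == r)).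
  rewrite /adjacent eqSS.
  by case: (ltngtP s r) => h1; case: (ltngtP s r.+1) => h2; case: (ltngtP s.+1 r) => h3 //=; lia.
by rewrite signr_addb; ring.
Qed.

(** mu_r anticommutes with Q_r, and the factor -i is what makes such a product Hermitian with square
    1. *)
Lemma mu_hinvol r : (r <= K)%N -> hinvol (mu r).
Proof.
elim: r => [|r IH] rK; rewrite ?mu0 ?muS //; have [mm mh] := IH (ltnW rK).
have [QQ Qh] := Q_hinvol rK.
have mQ : mu r *m Q r = - (Q r *m mu r).
  by rewrite mu_Q ?(ltnW rK) // eqxx /= expr1 scaleN1r.
split.
  rewrite -scalemxAl -scalemxAr scalerA mulrNN -expr2 sqrCi [X in X *m _]mQ mulNmx.
  by rewrite -[Q r *m _ *m _]mulmxA [mu r *m (mu r *m _)]mulmxA mm mul1mx QQ scaleN1r opprK.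
by rewrite adj_scale adj_mul mh Qh rmorphN /= conjCi opprK mQ scalerN scaleNr opprK.
Qed.

(** Among the factors of such a string only Q_0 anticommutes with the closing bond. The value r = K
    is excluded since its string contains the last X. *)
Lemma mu_Qb r : (0 < r < K)%N -> mu r *m Qb = - (Qb *m mu r).
Proof.
case: r => // r; elim: r => [|r IH] rK.
  rewrite muS mu0 -scalemxAl -scalemxAr -mulmxA Qb_Q // -scalemxAr expr1 scaleN1r.
  by rewrite mulmxA Qb_m0 scalerN mulmxA.
rewrite [mu r.+2]muS -scalemxAl -scalemxAr -mulmxA Qb_Q // expr0 scale1r mulmxA.
by rewrite IH ?mulNmx ?scalerN ?mulmxA //; lia.
Qed.

Lemma hconj_mu t r : (r < K)%N ->
  hconj (gate cR t (Q r)) (mu r) =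
    cR (cos (2 * t)) *: mu r - cR (sin (2 * t)) *: mu r.+1.
Proof.
move=> rK; have anti : mu r *m Q r = - (Q r *m mu r).
  by rewrite mu_Q ?(ltnW rK) // eqxx expr1 scaleN1r.
rewrite hconj_gate_anti //; last exact: Q_hinvol.
by congr (_ + _); rewrite muS scalerA mulrN scaleNr opprK mulrC.
Qed.

Lemma hconj_muS t r : (r < K)%N ->
  hconj (gate cR t (Q r)) (mu r.+1) =
    cR (cos (2 * t)) *: mu r.+1 + cR (sin (2 * t)) *: mu r.
Proof.
move=> rK; have hQ := Q_hinvol rK.
have anti : mu r.+1 *m Q r = - (Q r *m mu r.+1).
  by rewrite mu_Q // eqxx orbT expr1 scaleN1r.
rewrite hconj_gate_anti //; congr (_ + _).
rewrite muS -scalemxAl -mulmxA (proj1 hQ) mulmx1 scalerA.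
by congr (_ *: _); rewrite mulrC mulrA mulNr -expr2 sqrCi opprK mul1r.
Qed.

Lemma hconj_mu_fixed t r s : (r <= K)%N -> (s < K)%N -> s != r -> s.+1 != r ->
  hconj (gate cR t (Q s)) (mu r) = mu r.
Proof.
move=> rK sK /negbTE h1 /negbTE h2; apply: (hconj_gate_comm conj_cR); first exact: Q_hinvol.
by rewrite mu_Q // h1 h2 /= expr0 scale1r.
Qed.

(** Gate l rotates the plane of mu_{q l} and mu_{q l + 1}. Below, [q_sep] says that the planes of
    one layer are disjoint, so each mu feels a single gate. *)
Definition layer (q : nat -> nat) t (r : seq nat) := gates cR t [seq Q (q l) | l <- r].

Section Layer.
Variables (q : nat -> nat) (t : R).
Hypothesis q_sep : forall l l', l != l' -> [&& q l != q l', q l != (q l').+1 & (q l).+1 != q l'].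

Lemma layer_fixed r l : (forall i, i \in r -> (q i < K)%N) -> (q l < K)%N -> l \notin r ->
  hconj (layer q t r) (mu (q l)) = mu (q l) /\
  hconj (layer q t r) (mu (q l).+1) = mu (q l).+1.
Proof.
elim/last_ind: r => [|r i IH] rK lK; first by rewrite !hconj1.
rewrite mem_rcons inE negb_or => /andP[li lr].
have [|h1 h2] := IH _ lK lr; first by move=> j jr; apply: rK; rewrite mem_rcons inE jr orbT.
have iK : (q i < K)%N by apply: rK; rewrite mem_rcons mem_head.
have /and3P[s1 s2 s3] := q_sep li.
rewrite /layer map_rcons gates_rcons !hconj_mull h1 h2.
by split; apply: hconj_mu_fixed => //; lia.
Qed.

Lemma layer_mu r l : uniq r -> (forall i, i \in r -> (q i < K)%N) -> l \in r ->
  hconj (layer q t r) (mu (q l)) =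
     cR (cos (2 * t)) *: mu (q l) - cR (sin (2 * t)) *: mu (q l).+1 /\
  hconj (layer q t r) (mu (q l).+1) =
     cR (cos (2 * t)) *: mu (q l).+1 + cR (sin (2 * t)) *: mu (q l).
Proof.
elim/last_ind: r => [//|r i IH]; rewrite rcons_uniq => /andP[ir ur] rK.
have rK' j : j \in r -> (q j < K)%N by move=> jr; apply: rK; rewrite mem_rcons inE jr orbT.
have iK : (q i < K)%N by apply: rK; rewrite mem_rcons mem_head.
rewrite /layer map_rcons gates_rcons !hconj_mull mem_rcons inE.
have [->|li] := eqVneq l i.
  by move=> _; have [-> ->] := layer_fixed rK' iK ir; rewrite hconj_mu // hconj_muS.
move=> lr; have [-> ->] := IH ur rK' lr; have lK := rK' _ lr.
have /and3P[s1 s2 s3] := q_sep li.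
rewrite -scaleNr !hconjD !(hconjZ _ _ (mu _)).
by rewrite !hconj_mu_fixed //; lia.
Qed.

Lemma layer_unitary r : (forall i, i \in r -> (q i < K)%N) ->
  layer q t r *m (layer q t r) ^t* = 1%:M.
Proof.
move=> rK; apply: (gates_unitary conj_cR) => P /mapP[i ir ->].
by apply: Q_hinvol; apply: rK.
Qed.

End Layer.

Section ChainEvolution.
Variable N : nat.
Hypothesis KN : K = N.*2.+1.

Definition maj (c : coefs R) : 'M[C]_n :=
  comb cR N (fun l => mu l.*2) (fun l => mu l.*2.+1) c.

Definition layerX (t : R) := layer double t (iota 0 N.+1).
Definition layerZZ (t : R) := layer (fun l => l.*2.+1) t (iota 0 N) *m gate cR t Qb.

Lemma layerX_unitary t : layerX t *m (layerX t) ^t* = 1%:M.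
Proof. by apply: layer_unitary => i; rewrite mem_iota; lia. Qed.

Lemma hconj_layerX t c : hconj (layerX t) (maj c) = maj (rotX t c).
Proof.
rewrite /maj comb_rotX hconj_sum; apply: eq_bigr => -[l /= lN] _.
have sep i j : i != j -> [&& i.*2 != j.*2, i.*2 != j.*2.+1 & i.*2.+1 != j.*2] by lia.
have [||h1 h2] := @layer_mu double t sep (iota 0 N.+1) l (iota_uniq _ _).
- by move=> i; rewrite mem_iota; lia.
- by rewrite mem_iota; lia.
by rewrite /layerX hconjD !(hconjZ _ _ (mu _)) h1 h2.
Qed.

Lemma hconj_layerZZ_open t c : c.1 0%N = 0 -> c.1 N.+1 = 0 -> c.2 N = 0 ->
  hconj (layer (fun l => l.*2.+1) t (iota 0 N)) (maj c) = maj (rotZZ t c).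
Proof.
move=> c0 c1 c2; set U := layer _ _ _.
rewrite [RHS](@comb_rotZZ _ _ cR _ N _ _ (fun l => hconj U (mu l.*2)) (fun l => hconj U (mu l.*2.+1))) //.
  rewrite hconj_sum; apply: eq_bigr => l _.
  by rewrite hconjD !(hconjZ _ _ (mu _)).
all: move=> l lN.
all: have sep i j : i != j -> [&& i.*2.+1 != j.*2.+1, i.*2.+1 != j.*2.+2 & i.*2.+2 != j.*2.+1] by lia.
all: have [||h1 h2] := @layer_mu (fun l => l.*2.+1) t sep (iota 0 N) l (iota_uniq _ _).
all: try by [move=> i; rewrite mem_iota; lia | rewrite mem_iota; lia].
- exact: h2.
- exact: h1.
Qed.

Lemma maj_Qb c : c.1 0%N = 0 -> c.2 N = 0 -> maj c *m Qb = - (Qb *m maj c).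
Proof.
(* Regrouped by bonds, only mu_1, ..., mu_{2N} occur, and all of them anticommute with [Qb]. *)
move=> c0 c2; rewrite /maj comb_shift // mulmx_suml mulmx_sumr -sumrN.
apply: eq_bigr => -[l /= lN] _.
rewrite mulmxDl mulmxDr -!scalemxAl -!scalemxAr opprD.
by rewrite !mu_Qb ?scalerN //; lia.
Qed.

(** Stated for a product because a single [maj] only anticommutes with [Qb], so that its gate would
    take it out of the linear span of the mu_r. *)
Lemma hconj_layerZZ t c d :
    c.1 0%N = 0 -> c.1 N.+1 = 0 -> c.2 N = 0 ->
    d.1 0%N = 0 -> d.1 N.+1 = 0 -> d.2 N = 0 ->
  hconj (layerZZ t) (maj c *m maj d) = maj (rotZZ t c) *m maj (rotZZ t d).
Proof.
move=> c0 c1 c2 d0 d1 d2; rewrite /layerZZ hconj_mull hconjM; last first.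
  by apply: layer_unitary => i; rewrite mem_iota; lia.
rewrite !hconj_layerZZ_open //; apply: hconj_gate_comm => //.
have rot1 e : e.1 0%N = 0 -> (rotZZ t e).1 0%N = 0.
  by move=> e0; rewrite /= e0 !mulr0 subr0.
have rot2 e : e.2 N = 0 -> e.1 N.+1 = 0 -> (rotZZ t e).2 N = 0.
  by move=> e2 e1; rewrite /= e1 e2 !mulr0 addr0.
have qc := maj_Qb (rot1 _ c0) (rot2 _ c2 c1).
have qd := maj_Qb (rot1 _ d0) (rot2 _ d2 d1).
by rewrite -[LHS]mulmxA qd mulmxN [maj (rotZZ t c) *m (Qb *m _)]mulmxA qc mulNmx opprK -[LHS]mulmxA.
Qed.

Definition quad (psi : 'cV[C]_n) (A : 'M[C]_n) : C := (psi ^t* *m A *m psi) 0 0.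

Lemma quad_mul U psi A : quad (U *m psi) A = quad psi (hconj U A).
Proof. by rewrite /quad /hconj adj_mul !mulmxA. Qed.

(** In the Heisenberg picture the last layer acts first, so the recursion transforms its argument
    before descending. *)
Fixpoint heis (gamma beta : seq R) (p : nat) (c : coefs R) : coefs R :=
  if p is j.+1 then heis gamma beta j (rotX gamma`_j (rotZZ beta`_j c)) else c.

Fixpoint chain_state (gamma beta : seq R) (psi0 : 'cV[C]_n) (p : nat) : 'cV[C]_n :=
  if p is j.+1 then
    layerZZ beta`_j *m (layerX gamma`_j *m chain_state gamma beta psi0 j)
  else psi0.

Lemma supported_heis gamma beta p lo hi c : (p <= lo)%N -> supported lo hi c ->
  supported (lo - p) (hi + p) (heis gamma beta p c).
Proof.
elim: p lo hi c => [|p IH] lo hi c plo sc /=; first by rewrite subn0 addn0.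
case: lo plo sc => // lo plo sc; rewrite subSS addnS -addSn.
by apply: IH => //; apply: supported_rotX; exact: supported_rotZZ.
Qed.

(** The two margins survive the induction: peeling a layer widens the support by one site on each
    side and leaves one layer fewer. At each stage the coefficients at the end sites vanish, as
    [hconj_layerZZ] demands. *)
Lemma quad_chain_state gamma beta psi0 p lo hi c d :
    (p < lo)%N -> (hi + p < N)%N -> supported lo hi c -> supported lo hi d ->
  quad (chain_state gamma beta psi0 p) (maj c *m maj d) =
  quad psi0 (maj (heis gamma beta p c) *m maj (heis gamma beta p d)).
Proof.
elim: p lo hi c d => [//|p IH] lo hi c d plo hiN sc sd.
case: lo plo sc sd => // lo plo sc sd /=.
have [c0 c1 c2] : [/\ c.1 0%N = 0, c.1 N.+1 = 0 & c.2 N = 0].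
  by split; [have [|//] := sc 0%N | have [|//] := sc N.+1 | have [|//] := sc N]; lia.
have [d0 d1 d2] : [/\ d.1 0%N = 0, d.1 N.+1 = 0 & d.2 N = 0].
  by split; [have [|//] := sd 0%N | have [|//] := sd N.+1 | have [|//] := sd N]; lia.
rewrite quad_mul hconj_layerZZ // quad_mul hconjM ?layerX_unitary // !hconj_layerX.
by apply: (IH lo hi.+1); try lia; apply: supported_rotX; exact: supported_rotZZ.
Qed.

Section Vacuum.
Variable psi0 : 'cV[C]_n.
Hypothesis psi0_norm : psi0 ^t* *m psi0 = 1%:M.
Hypothesis psi0_stab : forall l, (l < N)%N -> Q l.*2.+1 *m psi0 = psi0.

Lemma maj_adj c : (maj c) ^t* = maj c.
Proof.
rewrite /maj /comb adj_sum; apply: eq_bigr => -[l /= lN] _.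
by rewrite adj_add !adj_scale !conj_cR !(proj2 (@mu_hinvol _ _)) //; lia.
Qed.

Definition vac_coef (c : coefs R) (l : nat) : C := cR (c.2 l) - 'i * cR (c.1 l.+1).

Lemma maj_psi0 c : c.1 0%N = 0 -> c.2 N = 0 ->
  maj c *m psi0 = \sum_(l < N) vac_coef c l *: (mu l.*2.+1 *m psi0).
Proof.
move=> c0 c2; rewrite /maj comb_shift // mulmx_suml; apply: eq_bigr => -[l /= lN] _.
have -> : mu l.+1.*2 = - 'i *: (mu l.*2.+1 *m Q l.*2.+1) by rewrite doubleS muS.
rewrite mulmxDl -!scalemxAl -mulmxA psi0_stab // scalerA -scalerDl addrC.
by congr (_ *: _); rewrite mulrN mulrC.
Qed.

(** mu_{2l+1} applied to psi0 is a domain wall at bond l: an eigenvector for -1 of that bond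
    operator and for +1 of the other open bonds. Walls at distinct bonds are therefore
    orthogonal. *)
Lemma vac_orthonormal l m : (l < N)%N -> (m < N)%N ->
  psi0 ^t* *m (mu l.*2.+1 *m (mu m.*2.+1 *m psi0)) = ((l == m)%:R)%:M.
Proof.
move=> lN mN; have [->|lm] := eqVneq l m.
  have mK : (m.*2.+1 <= K)%N by lia.
  by rewrite [X in _ *m X]mulmxA (proj1 (mu_hinvol mK)) mul1mx psi0_norm.
set A := LHS; suff AN : A = - A.
  have /eqP : A + A = 0 by rewrite {1}AN addNr.
  by rewrite -mulr2n -scaler_nat scaler_eq0 pnatr_eq0 /= => /eqP ->; rewrite raddf0.
have QK : (l.*2.+1 < K)%N by lia.
have sQ : psi0 ^t* *m Q l.*2.+1 = psi0 ^t*.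
  by rewrite -(proj2 (Q_hinvol QK)) -adj_mul psi0_stab.
(* Q_{2l+1} fixes psi0, anticommutes with mu_{2l+1} and commutes with mu_{2m+1}. *)
rewrite {1}/A -sQ -mulmxA [Q _ *m _]mulmxA.
have -> : Q l.*2.+1 *m mu l.*2.+1 = - (mu l.*2.+1 *m Q l.*2.+1).
  by rewrite mu_Q ?(ltnW QK) // eqxx expr1 scaleN1r opprK.
rewrite mulNmx mulmxN -mulmxA [Q _ *m (mu m.*2.+1 *m _)]mulmxA.
have -> : Q l.*2.+1 *m mu m.*2.+1 = mu m.*2.+1 *m Q l.*2.+1.
  rewrite mu_Q //; last by lia.
  by rewrite (_ : _ || _ = false) ?expr0 ?scale1r //; lia.
by rewrite -[mu m.*2.+1 *m _ *m _]mulmxA psi0_stab.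
Qed.

(** [maj c] is Hermitian, so this is the inner product of [maj c *m psi0] and [maj d *m psi0] in the
    orthonormal domain-wall vectors. *)
Lemma quad_vacuum c d : c.1 0%N = 0 -> c.2 N = 0 -> d.1 0%N = 0 -> d.2 N = 0 ->
  quad psi0 (maj c *m maj d) =
  \sum_(l < N) (vac_coef c l)^*%R * vac_coef d l.
Proof.
move=> c0 c2 d0 d2; rewrite /quad -{1}(maj_adj c) mulmxA -adj_mul -mulmxA !maj_psi0 //.
rewrite adj_sum mulmx_suml summxE; apply: eq_bigr => -[l /= lN] _.
rewrite mulmx_sumr summxE (bigD1 (Ordinal lN)) //= big1 ?addr0; last first.
  move=> [m /= mN] ml; have lm : l != m by apply: contra ml => /eqP e; apply/eqP/val_inj.
  rewrite adj_scale adj_mul (proj2 (@mu_hinvol _ _)); last by lia.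
  rewrite -scalemxAl -scalemxAr -mulmxA vac_orthonormal // (negbTE lm).
  by rewrite !mxE mul0rn !mulr0.
rewrite adj_scale adj_mul (proj2 (@mu_hinvol _ _)); last by lia.
by rewrite -scalemxAl -scalemxAr -mulmxA vac_orthonormal // eqxx !mxE mulr1.
Qed.

End Vacuum.

End ChainEvolution.

End Clifford.

(** * Fourier space *)

Section FourierRow.
Variables (R : realType) (C : numClosedFieldType) (cR : {rmorphism R -> C}).
Implicit Types (x : C * C) (c : coefs R).

Definition row_rotX (t : R) x : C * C :=
  (cR (cos (2 * t)) * x.1 - cR (sin (2 * t)) * x.2,
   cR (cos (2 * t)) * x.2 + cR (sin (2 * t)) * x.1).

Definition row_rotZZ (z : C) (t : R) x : C * C :=
  (cR (cos (2 * t)) * x.1 + cR (sin (2 * t)) * z^-1 * x.2,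
   cR (cos (2 * t)) * x.2 - cR (sin (2 * t)) * z * x.1).

(* Transposes heis at z = e^{ik}, so that the layers act in the order of time;
   the initial row is read off mu_{2l+2}|0..0> = - i mu_{2l+1}|0..0>. *)
Fixpoint row_iter (gamma beta : seq R) (z : C) (p : nat) : C * C :=
  if p is j.+1 then
    row_rotZZ z beta`_j (row_rotX gamma`_j (row_iter gamma beta z j))
  else (- 'i * z^-1, 1).

(** The Fourier transforms of [c.1] and [c.2], contracted with the row x; rotations of c pass to x
    by transposition, a shift by one site becoming a factor z or its inverse. *)
Definition pairing (N : nat) (z : C) x c : C :=
  \sum_(l < N.+1) z ^+ l * (cR (c.1 l) * x.1 + cR (c.2 l) * x.2).

Lemma pairing_comb N z x c : pairing N z x c =
  comb cR (V := C^o) N (fun l => z ^+ l * x.1) (fun l => z ^+ l * x.2) c.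
Proof. by apply: eq_bigr => l _; rewrite /= /GRing.scale /=; ring. Qed.

Lemma pairing_rotX N z x t c :
  pairing N z x (rotX t c) = pairing N z (row_rotX t x) c.
Proof.
apply: eq_bigr => l _; rewrite /= !(rmorphD, rmorphN, rmorphM) /=; ring.
Qed.

Lemma pairing_rotZZ N z x t c : z != 0 ->
    c.1 0%N = 0 -> c.1 N.+1 = 0 -> c.2 N = 0 ->
  pairing N z x (rotZZ t c) = pairing N z (row_rotZZ z t x) c.
Proof.
move=> z0 c0 c1 c2; rewrite !pairing_comb.
apply: comb_rotZZ => // l lN; rewrite /GRing.scale /= exprS; first by field.
by ring.
Qed.

Lemma pairing_heis N z gamma beta p lo hi c : z != 0 ->
    (p < lo)%N -> (hi + p < N)%N -> supported lo hi c ->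
  pairing N z (row_iter gamma beta z 0) (heis gamma beta p c) =
  pairing N z (row_iter gamma beta z p) c.
Proof.
move=> z0; elim: p lo hi c => [//|p IH] [//|lo] hi c plo hiN sc.
rewrite [heis _ _ _ _]/= (IH lo hi.+1); try lia; last first.
  by apply: supported_rotX; exact: supported_rotZZ.
rewrite pairing_rotX pairing_rotZZ //.
- by have [|] := sc 0%N; [lia|].
- by have [|] := sc N.+1; [lia|].
- by have [|] := sc N; [lia|].
Qed.

Lemma vac_coef_series N z c : z != 0 -> c.1 0%N = 0 -> c.2 N = 0 ->
  \sum_(l < N) z ^+ l * vac_coef cR c l = pairing N z (row_iter [::] [::] z 0) c.
Proof.
move=> z0 c0 c2; rewrite pairing_comb comb_shift //; apply: eq_bigr => l _.
by rewrite /vac_coef /GRing.scale /= exprS; field.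
Qed.

Definition unit_even (j : nat) : coefs R := (fun l => (l == j)%:R, fun=> 0).
Definition unit_odd (j : nat) : coefs R := (fun=> 0, fun l => (l == j)%:R).

Lemma supported_even j : supported j j (unit_even j).
Proof. by move=> l h; split=> //=; case: eqP => // e; move: h; rewrite e ltnn. Qed.

Lemma supported_odd j : supported j j (unit_odd j).
Proof. by move=> l h; split=> //=; case: eqP => // e; move: h; rewrite e ltnn. Qed.

Lemma comb_even (V : lmodType C) N (fe fo : nat -> V) j : (j <= N)%N ->
  comb cR N fe fo (unit_even j) = fe j.
Proof.
move=> jN; rewrite /comb (bigD1 (Ordinal (jN : j < N.+1)%N)) //= big1 => [|i ij].
  by rewrite eqxx rmorph1 rmorph0 scale1r scale0r !addr0.
have /negbTE -> : (i : nat) != j by apply: contra ij => /eqP e; apply/eqP/val_inj.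
by rewrite rmorph0 !scale0r addr0.
Qed.

Lemma comb_odd (V : lmodType C) N (fe fo : nat -> V) j : (j <= N)%N ->
  comb cR N fe fo (unit_odd j) = fo j.
Proof.
move=> jN; rewrite /comb (bigD1 (Ordinal (jN : j < N.+1)%N)) //= big1 => [|i ij].
  by rewrite eqxx rmorph1 rmorph0 scale1r scale0r add0r addr0.
have /negbTE -> : (i : nat) != j by apply: contra ij => /eqP e; apply/eqP/val_inj.
by rewrite rmorph0 !scale0r addr0.
Qed.

Lemma vac_series_heis N z gamma beta p lo hi c : z != 0 ->
    (p < lo)%N -> (hi + p < N)%N -> supported lo hi c ->
  \sum_(l < N) z ^+ l * vac_coef cR (heis gamma beta p c) l =
  pairing N z (row_iter gamma beta z p) c.
Proof.
move=> z0 plo hiN sc; rewrite vac_coef_series //.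
- exact: (pairing_heis gamma beta z0 plo hiN sc).
- by have [|//] := @supported_heis _ gamma beta p lo hi c (ltnW plo) sc 0%N; lia.
- by have [|//] := @supported_heis _ gamma beta p lo hi c (ltnW plo) sc N; lia.
Qed.

End FourierRow.

(** * The closed chain *)

Section Chain.
Variables (R : realType) (N : nat).
Local Notation C := (Cplx R).

(** Indexed by [nat] to match the strings [mu]. An index above N falls back to site 0 through
    [inord], hence the bounds in the mixed commutation rules. *)
Definition siteX (l : nat) : 'M[C]_(hdim N.+1) := at_site (inord l) (pauliX R).
Definition siteZ (l : nat) : 'M[C]_(hdim N.+1) := at_site (inord l) (pauliZ R).

Lemma siteXX l : siteX l *m siteX l = 1%:M.
Proof. by rewrite /siteX at_siteM pauliXX at_site1. Qed.

Lemma siteZZ l : siteZ l *m siteZ l = 1%:M.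
Proof. by rewrite /siteZ at_siteM pauliZZ at_site1. Qed.

Lemma siteX_adj l : (siteX l) ^t* = siteX l.
Proof. by rewrite at_site_adj pauliX_adj. Qed.

Lemma siteZ_adj l : (siteZ l) ^t* = siteZ l.
Proof. by rewrite at_site_adj pauliZ_adj. Qed.

Lemma siteX_comm l m : siteX l *m siteX m = siteX m *m siteX l.
Proof.
have [e|ne] := eqVneq (inord l : 'I_N.+1) (inord m); first by rewrite /siteX e.
exact: at_site_comm.
Qed.

Lemma siteZ_comm l m : siteZ l *m siteZ m = siteZ m *m siteZ l.
Proof.
have [e|ne] := eqVneq (inord l : 'I_N.+1) (inord m); first by rewrite /siteZ e.
exact: at_site_comm.
Qed.

Lemma siteXZ l m : (l <= N)%N -> (m <= N)%N ->
  siteX l *m siteZ m = (-1) ^+ (l == m) *: (siteZ m *m siteX l).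
Proof.
move=> lN mN; have [->|ne] := eqVneq l m.
  by rewrite expr1 scaleN1r /siteX /siteZ !at_siteM pauliXZ at_siteN.
rewrite expr0 scale1r at_site_comm //.
by apply: contra ne => /eqP /(congr1 val); rewrite /= !inordK // => ->.
Qed.

Lemma siteZX l m : (l <= N)%N -> (m <= N)%N ->
  siteZ l *m siteX m = (-1) ^+ (m == l) *: (siteX m *m siteZ l).
Proof. by move=> lN mN; rewrite siteXZ // scalerA -expr2 sqrr_sign scale1r. Qed.

Definition bond (l m : nat) := siteZ l *m siteZ m.

Lemma bond_hinvol l m : hinvol (bond l m).
Proof.
split; last by rewrite /bond adj_mul !siteZ_adj siteZ_comm.
by rewrite /bond {1}(siteZ_comm l m) -mulmxA [siteZ l *m _]mulmxA siteZZ mul1mx siteZZ.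
Qed.

Lemma siteX_hinvol l : hinvol (siteX l).
Proof. by split; [exact: siteXX|exact: siteX_adj]. Qed.

Lemma bond_comm l m l' m' : bond l m *m bond l' m' = bond l' m' *m bond l m.
Proof.
by apply: mulmx_comm2; apply/esym; apply: mulmx_comm2; exact: siteZ_comm.
Qed.

Lemma siteX_bond l m k : (l <= N)%N -> (m <= N)%N -> (k <= N)%N ->
  siteX k *m bond l m = (-1) ^+ ((k == l) (+) (k == m)) *: (bond l m *m siteX k).
Proof.
move=> lN mN kN; by rewrite signr_addb; apply: mulmx_scale_comm; exact: siteXZ.
Qed.

Definition link (r : nat) : 'M[C]_(hdim N.+1) :=
  if odd r then bond r./2 r./2.+1 else siteX r./2.

Lemma link_even l : link l.*2 = siteX l.
Proof. by rewrite /link odd_double doubleK. Qed.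

Lemma link_odd l : link l.*2.+1 = bond l l.+1.
Proof. by rewrite /link /= odd_double /= uphalf_double. Qed.

Lemma link_hinvol r : hinvol (link r).
Proof. by rewrite /link; case: ifP => _; [exact: bond_hinvol|exact: siteX_hinvol]. Qed.

(** X operators commute with each other and so do bonds; X_k anticommutes with an open bond exactly
    when it sits at one of its ends, that is when the indices are adjacent. The four parity cases
    say this. *)
Lemma link_comm r s : (r < N.*2.+1)%N -> (s < N.*2.+1)%N ->
  link r *m link s = (-1) ^+ adjacent r s *: (link s *m link r).
Proof.
rewrite -[r in X in X -> _](odd_double_half r) -[s in X in _ -> X -> _](odd_double_half s).
move=> rK sK; rewrite /link /adjacent.
rewrite -[r in s == r.+1](odd_double_half r) -[s in s == _](odd_double_half s).
rewrite -[r in _.+1 == r](odd_double_half r) -[s in s.+1 == _](odd_double_half s).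
move: (r./2) (s./2) rK sK => l m; case: (odd r); case: (odd s) => /=; rewrite ?add0n ?add1n => lK mK.
- rewrite bond_comm (_ : _ || _ = false) ?expr0 ?scale1r //; lia.
- rewrite siteX_bond; try lia.
  rewrite scalerA -signr_addb (_ : _ (+) _ = false) ?expr0 ?scale1r //; lia.
- rewrite siteX_bond; try lia.
  congr (_ ^+ nat_of_bool _ *: _); lia.
- rewrite siteX_comm (_ : _ || _ = false) ?expr0 ?scale1r //; lia.
Qed.

Lemma site0_link s : (s < N.*2.+1)%N ->
  siteZ 0 *m link s = (-1) ^+ (s == 0%N) *: (link s *m siteZ 0).
Proof.
move=> sK; rewrite /link; have [os|es] := boolP (odd s).
  have /negbTE -> : s != 0%N by case: s os {sK}.
  by rewrite expr0 scale1r /bond mulmxA siteZ_comm -mulmxA (siteZ_comm 0) mulmxA.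
rewrite siteZX //; last by lia.
by congr (_ ^+ nat_of_bool _ *: _); lia.
Qed.

Lemma site0_boundary : siteZ 0 *m bond N 0 = bond N 0 *m siteZ 0.
Proof. by rewrite /bond mulmxA (siteZ_comm 0) -!mulmxA. Qed.

(** The bound excludes s = 2N, that is X_N, the other operator touching the closing bond. *)
Lemma link_boundary s : (s.+1 < N.*2.+1)%N ->
  link s *m bond N 0 = (-1) ^+ (s == 0%N) *: (bond N 0 *m link s).
Proof.
move=> sK; rewrite /link; have [os|es] := boolP (odd s).
  have /negbTE -> : s != 0%N by case: s os {sK}.
  by rewrite bond_comm expr0 scale1r.
rewrite siteX_bond //; last by lia.
by congr (_ ^+ nat_of_bool _ *: _); lia.
Qed.

Definition vac : 'cV[C]_(hdim N.+1) := tensor_vec (fun _ : 'I_N.+1 => ket0 R).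

Lemma vac_norm : vac ^t* *m vac = 1%:M.
Proof. by apply: tensor_vec_norm; exact: ket0_norm. Qed.

Lemma bond_vac l m : bond l m *m vac = vac.
Proof. by rewrite /bond -mulmxA /siteZ !at_site_stab //; exact: pauliZ_ket0. Qed.

Lemma evol_H2 t : evol t (H2 R N.+1) = layerX (@cR R) link N t.
Proof.
rewrite /H2 (_ : \sum_j _ = \sum_(l <- iota 0 N.+1) siteX l); last first.
  rewrite -[iota 0 N.+1]/(index_iota 0 N.+1) big_mkord.
  by apply: eq_bigr => j _; rewrite /siteX inord_val.
rewrite evol_gates; [|exact: siteXX|exact: siteX_comm].
by rewrite /layerX /layer; congr (gates _ _ _); apply: eq_map => l; rewrite link_even.
Qed.

Lemma evol_H1 t : evol t (H1 R N.+1) = layerZZ (@cR R) link (bond N 0) N t.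
Proof.
pose nb l : nat := ordS (inord l : 'I_N.+1).
rewrite /H1 (_ : \sum_j _ = \sum_(l <- iota 0 N.+1) bond l (nb l)); last first.
  rewrite -[iota 0 N.+1]/(index_iota 0 N.+1) big_mkord.
  by apply: eq_bigr => j _; rewrite /bond /siteZ /nb !inord_val.
rewrite evol_gates; last first.
- by move=> l m; exact: bond_comm.
- by move=> l; exact: (proj1 (bond_hinvol _ _)).
(* The bond of the last site closes the ring, so its gate is split off. *)
rewrite -[X in iota 0 X]addn1 iotaD map_cat /= cats1 gates_rcons /layerZZ.
have -> : nb (0 + N)%N = 0%N by rewrite add0n /nb /= inordK // modnn.
have -> : [seq bond i (nb i) | i <- iota 0 N] = [seq link l.*2.+1 | l <- iota 0 N].
  apply/eq_in_map => l; rewrite mem_iota => lN.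
  by rewrite link_odd /nb /= inordK ?modn_small //; lia.
by rewrite add0n.
Qed.

Lemma qaoa_chain gamma beta p :
  qaoa_state N.+1 gamma beta p = chain_state (@cR R) link (bond N 0) N gamma beta vac p.
Proof. by elim: p => //= p ->; rewrite evol_H1 evol_H2. Qed.

Lemma expval_quad n (psi : 'cV[C]_n) A : expval psi A = quad psi A.
Proof. by []. Qed.

Lemma expval_hermitian n (psi : 'cV[C]_n) A : A ^t* = A ->
  ((expval psi A)^*)%R = expval psi A.
Proof.
move=> hA; rewrite /expval -[in RHS]hA.
have -> : psi ^t* *m A ^t* *m psi = (psi ^t* *m A *m psi) ^t*.
  rewrite !adj_mul mulmxA; congr (_ *m _ *m _).
  by apply/matrixP => i j; rewrite !mxE conjCK.
by rewrite !mxE.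
Qed.

Lemma expval_bulk gamma beta p j : (p < j)%N -> (j + p < N)%N ->
  expval (qaoa_state N.+1 gamma beta p) (siteX j) =
  'i * \sum_(l < N) (vac_coef (@cR R) (heis gamma beta p (unit_even R j)) l)^*%R
                    * vac_coef (@cR R) (heis gamma beta p (unit_odd R j)) l.
Proof.
move=> pj jN; set m := mu link (siteZ 0).
have m0i : hinvol (siteZ 0) by split; [exact: siteZZ|exact: siteZ_adj].
have mi r : (r <= N.*2.+1)%N -> hinvol (m r).
  exact: (mu_hinvol (fun r _ => link_hinvol r) link_comm m0i site0_link).
(* Multiply mu_{2j+1} = - i mu_{2j} X_j on the left by mu_{2j}, whose square is 1. *)
have X_mu : siteX j = ('i : C) *: (m j.*2 *m m j.*2.+1).
  rewrite /m muS -scalemxAr scalerA mulmxA mulrN -expr2 sqrCi opprK scale1r.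
  by rewrite (proj1 (mi _ _)) ?mul1mx ?link_even //; lia.
have jN' : (j <= N)%N by lia.
have maje : maj (@cR R) link (siteZ 0) N (unit_even R j) = m j.*2.
  by rewrite /maj comb_even.
have majo : maj (@cR R) link (siteZ 0) N (unit_odd R j) = m j.*2.+1.
  by rewrite /maj comb_odd.
have conj_cR := @conj_real R.
have := quad_chain_state conj_cR (fun r _ => link_hinvol r) link_comm site0_link
  (bond_hinvol N 0) site0_boundary link_boundary (erefl _) gamma beta vac pj jN
  (@supported_even R j) (@supported_odd R j).
rewrite maje majo -qaoa_chain => e.
rewrite X_mu expval_quad /quad -scalemxAr -scalemxAl mxE -/(quad _ _) e.
congr (_ * _).
have hs c (sc : supported j j c) : [/\ (heis gamma beta p c).1 0%N = 0 & (heis gamma beta p c).2 N = 0].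
  by split; [have [|//] := @supported_heis _ gamma beta p j j c (ltnW pj) sc 0%N
    |have [|//] := @supported_heis _ gamma beta p j j c (ltnW pj) sc N]; lia.
have [h1 h2] := hs _ (@supported_even R j).
have [h3 h4] := hs _ (@supported_odd R j).
apply: (quad_vacuum conj_cR (fun r _ => link_hinvol r) link_comm m0i site0_link
  (erefl _) vac_norm _ h1 h2 h3 h4) => l lN.
by rewrite link_odd bond_vac.
Qed.

End Chain.

(** * Translation invariance *)

Section Relabelling.
Variables (C : numClosedFieldType) (n : nat) (f g : 'I_n -> 'I_n).
Hypotheses (fK : cancel f g) (gK : cancel g f).

(** A bijection of the summation index leaves the product unchanged; thus [mxsub f f], conjugation
    by a permutation matrix, is multiplicative. *)
Lemma mxsub_mul m p (A : 'M[C]_(m, n)) (B : 'M[C]_(n, p)) m' p' (h : 'I_m' -> 'I_m)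
    (k : 'I_p' -> 'I_p) :
  mxsub h k (A *m B) = mxsub h f A *m mxsub f k B.
Proof.
apply/matrixP => i j; rewrite !mxE (reindex f) /=; last by exists g => ? _; rewrite ?fK ?gK.
by apply: eq_bigr => l _; rewrite !mxE.
Qed.

Lemma mxsub1 : mxsub f f (1%:M : 'M[C]_n) = 1%:M.
Proof. by apply/matrixP => i j; rewrite !mxE (inj_eq (can_inj fK)). Qed.

Lemma mxsub_sum (I : Type) (r : seq I) (F : I -> 'M[C]_n) :
  mxsub f f (\sum_(i <- r) F i) = \sum_(i <- r) mxsub f f (F i).
Proof.
elim: r => [|i r IH]; first by rewrite !big_nil; apply/matrixP => i j; rewrite !mxE.
by rewrite !big_cons -IH; apply/matrixP => a b; rewrite !mxE.
Qed.

Lemma mxsub_scale (c : C) (A : 'M[C]_n) : mxsub f f (c *: A) = c *: mxsub f f A.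
Proof. by apply/matrixP => i j; rewrite !mxE. Qed.

Lemma mxsub_opp (A : 'M[C]_n) : mxsub f f (- A) = - mxsub f f A.
Proof. by apply/matrixP => i j; rewrite !mxE. Qed.

Variables (R : realType) (cR : {rmorphism R -> C}).

Lemma spectral_family_mxsub (A : 'M[C]_n) s : spectral_family cR A s ->
  spectral_family cR (mxsub f f A) [seq (x.1, mxsub f f x.2) | x <- s].
Proof.
move=> sA k; rewrite big_map.
have -> : mxsub f f A ^+ k = mxsub f f (A ^+ k).
  elim: k => [|k IH]; first by rewrite !expr0 mxsub1.
  by rewrite !exprS IH -!mulmxE mxsub_mul.
by rewrite sA mxsub_sum; apply: eq_bigr => x _; rewrite mxsub_scale.
Qed.

Lemma spectral_evol_mxsub t s :
  spectral_evol cR t [seq (x.1, mxsub f f x.2) | x <- s] =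
  mxsub f f (spectral_evol cR t s) :> 'M[C]_n.
Proof.
rewrite /spectral_evol big_map mxsub_sum.
by apply: eq_bigr => x _; rewrite mxsub_scale.
Qed.

End Relabelling.

Section Translation.
Variables (R : realType) (L : nat) (sigma tau : 'I_L -> 'I_L).
Local Notation C := (Cplx R).
Hypotheses (sigmaK : cancel sigma tau) (tauK : cancel tau sigma).
Hypothesis sigma_ordS : forall i, sigma (ordS i) = ordS (sigma i).

Definition relabel (h : 'I_L -> 'I_L) (s : 'I_(hdim L)) : 'I_(hdim L) :=
  enum_rank [ffun i => label s (h i)].

Lemma label_relabel h s i : label (relabel h s) i = label s (h i).
Proof. by rewrite /label /relabel enum_rankK ffunE. Qed.

Lemma relabelK h k : cancel h k -> cancel (relabel k) (relabel h).
Proof.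
move=> hk s; apply: enum_val_inj; apply/ffunP => i.
by rewrite -/(label _) label_relabel label_relabel hk.
Qed.

Local Notation rel := (mxsub (relabel sigma) (relabel sigma)).

Let relK := relabelK tauK.
Let relK' := relabelK sigmaK.

Lemma rel_at_site j (A : 'M[C]_2) : rel (at_site j A) = at_site (sigma j) A.
Proof.
apply/matrixP => s t; rewrite !mxE [RHS](reindex sigma) /=; last first.
  by exists tau => ? _; rewrite ?sigmaK ?tauK.
by apply: eq_bigr => i _; rewrite !label_relabel (inj_eq (can_inj sigmaK)).
Qed.

Lemma rel_H2 : rel (H2 R L) = H2 R L.
Proof.
rewrite /H2 mxsub_opp mxsub_sum [in RHS](reindex sigma) /=; last first.
  by exists tau => ? _; rewrite ?sigmaK ?tauK.
by congr (- _); apply: eq_bigr => j _; rewrite rel_at_site.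
Qed.

Lemma rel_H1 : rel (H1 R L) = H1 R L.
Proof.
rewrite /H1 mxsub_opp mxsub_sum [in RHS](reindex sigma) /=; last first.
  by exists tau => ? _; rewrite ?sigmaK ?tauK.
congr (- _); apply: eq_bigr => j _.
by rewrite (mxsub_mul relK relK') !rel_at_site sigma_ordS.
Qed.

(** The relabelled spectral family is a family of the same invariant Hamiltonian, so both compute
    the same exponential. *)
Lemma rel_evol t (I : Type) (r : seq I) (Q : I -> 'M[C]_(hdim L)) :
    (forall i, Q i *m Q i = 1%:M) -> (forall i j, Q i *m Q j = Q j *m Q i) ->
    rel (- \sum_(i <- r) Q i) = - \sum_(i <- r) Q i ->
  rel (evol t (- \sum_(i <- r) Q i)) = evol t (- \sum_(i <- r) Q i).
Proof.
move=> QQ QC relQ; have [s [h1 _]] := spectral_gates (@cR R) t r QQ QC.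
rewrite -[in RHS]relQ (evol_spectral t h1).
by rewrite (evol_spectral t (spectral_family_mxsub relK relK' h1)) spectral_evol_mxsub.
Qed.

Lemma at_siteX_sq (j : 'I_L) : at_site j (pauliX R) *m at_site j (pauliX R) = 1%:M.
Proof. by rewrite at_siteM pauliXX at_site1. Qed.

Lemma at_site_comm_self (j k : 'I_L) (A : 'M[C]_2) :
  at_site j A *m at_site k A = at_site k A *m at_site j A.
Proof. by have [->//|jk] := eqVneq j k; exact: at_site_comm. Qed.

Lemma rel_evol_H2 t : rel (evol t (H2 R L)) = evol t (H2 R L).
Proof.
apply: rel_evol; last exact: rel_H2; first exact: at_siteX_sq.
by move=> j k; exact: at_site_comm_self.
Qed.

Lemma rel_evol_H1 t : rel (evol t (H1 R L)) = evol t (H1 R L).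
Proof.
have ZC (j k : 'I_L) := at_site_comm_self j k (pauliZ R).
apply: rel_evol; last exact: rel_H1.
  move=> j; rewrite -[X in _ *m X]ZC mulmxA -[X in X *m _]mulmxA.
  by rewrite !at_siteM pauliZZ at_site1 mulmx1 at_siteM pauliZZ at_site1.
by move=> j k; apply: mulmx_comm2; apply/esym; apply: mulmx_comm2; exact: ZC.
Qed.

Local Notation relv := (mxsub (relabel sigma) id).

Lemma relv_qaoa (gamma beta : seq R) p :
  relv (qaoa_state L gamma beta p) = qaoa_state L gamma beta p.
Proof.
elim: p => [|p IH].
  apply/matrixP => s t; rewrite !mxE [RHS](reindex sigma) /=; last first.
    by exists tau => ? _; rewrite ?sigmaK ?tauK.
  by apply: eq_bigr => i _; rewrite label_relabel.
rewrite [qaoa_state _ _ _ _]/= !(mxsub_mul relK relK').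
rewrite IH.
exact: (congr2 mulmx (rel_evol_H1 beta`_p) (congr2 mulmx (rel_evol_H2 gamma`_p) erefl)).
Qed.

Lemma expval_translate (gamma beta : seq R) p j (A : 'M[C]_2) :
  expval (qaoa_state L gamma beta p) (at_site (sigma j) A) =
  expval (qaoa_state L gamma beta p) (at_site j A).
Proof.
rewrite /expval -rel_at_site -[in LHS](relv_qaoa gamma beta p).
set psi := qaoa_state _ _ _ _.
have -> : (relv psi) ^t* = mxsub id (relabel sigma) (psi ^t*).
  by apply/matrixP => a b; rewrite !mxE.
by rewrite -!(mxsub_mul relK relK') mxE.
Qed.

End Translation.

Lemma expval_site_independent (R : realType) (L : nat) (gamma beta : seq R) p (j j' : 'I_L)
    (A : 'M[Cplx R]_2) :
  expval (qaoa_state L gamma beta p) (at_site j A) =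
  expval (qaoa_state L gamma beta p) (at_site j' A).
Proof.
case: L j j' => [|N] j j'; first by case: j.
(* Translation by d in the cyclic group of sites commutes with [ordS], which is addition of 1. *)
pose d : 'I_N.+1 := j' - j.
have <- : j + d = j' by rewrite /d addrC subrK.
apply/esym; apply: (@expval_translate R N.+1 (fun i => i + d) (fun i => i - d)).
- by move=> i; rewrite addrK.
- by move=> i; rewrite subrK.
- by move=> i; apply: val_inj; rewrite /= modnDml -[in RHS]addn1 modnDml addn1 addSn.
Qed.

(** * The recursion on the Riemann sphere *)

Section RowAlgebra.
Variables (R : realType) (C : numClosedFieldType) (cR : {rmorphism R -> C}).
Implicit Types x : C * C.

(* In homogeneous coordinates, f_{2j} = [zzplus : zzminus] and
   g_{2j} = [xminus : xplus], evaluated at the row after j steps. *)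
Definition xplus x : C := x.1 + 'i * x.2.
Definition xminus x : C := x.1 - 'i * x.2.
Definition zzplus (z : C) x : C := z * x.1 + 'i * x.2.
Definition zzminus (z : C) x : C := z * x.1 - 'i * x.2.

Let i2 : ('i * 'i : C) = -1. Proof. by rewrite -expr2 sqrCi. Qed.

Lemma cis_expN2 t : cis cR (- 4 * t) * (cis cR (2 * t) * cis cR (2 * t)) = 1.
Proof.
by rewrite -!cisD (_ : _ + _ = 0) ?cis0 //; ring.
Qed.

Lemma cis_mulN t : cis cR t * (cR (cos t) - 'i * cR (sin t)) = 1.
Proof.
rewrite /cis; have := congr1 cR (cos2Dsin2 t); rewrite rmorphD rmorph1 !rmorphXn /= => e.
by rewrite -e; ring: i2.
Qed.

(** [xplus] and [xminus] diagonalize the X rotation, [zzplus] and [zzminus] the ZZ rotation. The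
    ratio of the two eigenphases is the e^{-4it} of the recursion. *)
Lemma xplus_rotX t x : xplus (row_rotX cR t x) = cis cR (2 * t) * xplus x.
Proof. by rewrite /xplus /row_rotX /cis /=; ring: i2. Qed.

Lemma xminus_rotX t x :
  xminus (row_rotX cR t x) = (cR (cos (2 * t)) - 'i * cR (sin (2 * t))) * xminus x.
Proof. by rewrite /xminus /row_rotX /=; ring: i2. Qed.

Lemma zzplus_rotZZ z t x : z != 0 ->
  zzplus z (row_rotZZ cR z t x) = (cR (cos (2 * t)) - 'i * cR (sin (2 * t))) * zzplus z x.
Proof.
move=> z0; have zV : z * z^-1 = 1 by rewrite mulfV.
by rewrite /zzplus /row_rotZZ /=; ring: i2 zV.
Qed.

Lemma zzminus_rotZZ z t x : z != 0 ->
  zzminus z (row_rotZZ cR z t x) = cis cR (2 * t) * zzminus z x.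
Proof.
move=> z0; have zV : z * z^-1 = 1 by rewrite mulfV.
by rewrite /zzminus /row_rotZZ /cis /=; ring: i2 zV.
Qed.

Lemma odd_coords z t x : z + 1 != 0 -> z != 0 ->
  let tau := (z - 1) / (z + 1) in let e := cis cR (- 4 * t) in
  let y := row_rotX cR t x in
  exists2 u, u != 0 &
   xminus y = u * (- (e * tau) * zzplus z x + e * zzminus z x) /\
   xplus y = u * (1 * zzplus z x + - tau * zzminus z x).
Proof.
move=> z1 z0 /=; set w := cis cR (2 * t).
have ew := cis_expN2 t; have wV := cis_mulN (2 * t); rewrite -/w in ew wV.
have w0 : w != 0 by apply: contra_eq_neq wV => ->; rewrite mul0r eq_sym oner_eq0.
have h2 : (2 : C) != 0 by rewrite pnatr_eq0.
(* Expressing [xplus] and [xminus] through [zzplus] and [zzminus] leaves the common factor (z +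
   1)/(2z); w is the phase of [xplus]. *)
exists (w * (z + 1) / (2 * z)).
  by rewrite !mulf_neq0 // invr_eq0 mulf_neq0.
rewrite xplus_rotX xminus_rotX -/w.
have -> : cR (cos (2 * t)) - 'i * cR (sin (2 * t)) = cis cR (- 4 * t) * w.
  by apply: (mulfI w0); rewrite wV -ew; ring.
by rewrite /xplus /xminus /zzplus /zzminus; split; field; rewrite ?z0 ?z1.
Qed.

Lemma even_coords z t x : z + 1 != 0 -> z != 0 ->
  let tau := (z - 1) / (z + 1) in let e := cis cR (- 4 * t) in
  let y := row_rotZZ cR z t x in
  exists2 u, u != 0 &
   zzplus z y = u * (e * tau * xminus x + e * xplus x) /\
   zzminus z y = u * (1 * xminus x + tau * xplus x).
Proof.
move=> z1 z0 /=; set w := cis cR (2 * t).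
have ew := cis_expN2 t; have wV := cis_mulN (2 * t); rewrite -/w in ew wV.
have w0 : w != 0 by apply: contra_eq_neq wV => ->; rewrite mul0r eq_sym oner_eq0.
have h2 : (2 : C) != 0 by rewrite pnatr_eq0.
exists (w * (z + 1) / 2).
  by rewrite !mulf_neq0 // invr_eq0.
rewrite zzplus_rotZZ // zzminus_rotZZ // -/w.
have -> : cR (cos (2 * t)) - 'i * cR (sin (2 * t)) = cis cR (- 4 * t) * w.
  by apply: (mulfI w0); rewrite wV -ew; ring.
by rewrite /xplus /xminus /zzplus /zzminus; split; field; rewrite ?z0 ?z1.
Qed.

Lemma final_coords z x : z + 1 != 0 -> z != 0 ->
  let tau := (z - 1) / (z + 1) in
  exists2 u, u != 0 &
   xminus x = u * (- tau * zzplus z x + 1 * zzminus z x) /\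
   xplus x = u * (1 * zzplus z x + - tau * zzminus z x).
Proof.
move=> z1 z0 /=.
have h2 : (2 : C) != 0 by rewrite pnatr_eq0.
exists ((z + 1) / (2 * z)).
  by rewrite !mulf_neq0 // invr_eq0 mulf_neq0.
by rewrite /xplus /xminus /zzplus /zzminus; split; field; rewrite ?z0 ?z1.
Qed.

Hypothesis conj_cR : forall y, (cR y)^*%R = cR y.

(** On the unit circle both rotations are unitary, and the initial row has two entries of modulus 1,
    whence the value 2. *)
Lemma row_iter_norm gamma beta z p : z != 0 -> (z^*)%R = z^-1 ->
  let x := row_iter cR gamma beta z p in
  x.1 * (x.1^*)%R + x.2 * (x.2^*)%R = 2.
Proof.
move=> z0 zJ /=; elim: p => [|p].
  rewrite /= !(rmorphM, rmorphN, fmorphV, rmorph1) /= zJ conjCi.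
  by field: i2.
have zV : z * z^-1 = 1 by rewrite mulfV.
rewrite -[row_iter _ _ _ _ p.+1]/(row_rotZZ cR z beta`_p (row_rotX cR gamma`_p
  (row_iter cR gamma beta z p))).
move: (row_iter _ _ _ _ _) => x <-.
have tt t := congr1 cR (cos2Dsin2 t).
have hX (t : R) (y : C * C) :
    (row_rotX cR t y).1 * ((row_rotX cR t y).1^*)%R +
    (row_rotX cR t y).2 * ((row_rotX cR t y).2^*)%R =
    y.1 * (y.1^*)%R + y.2 * (y.2^*)%R.
  have := tt (2 * t); rewrite rmorphD !rmorphXn rmorph1 /= => e.
  rewrite !(rmorphD, rmorphN, rmorphM) /= !conj_cR.
  by rewrite -[RHS]mul1r -e; ring.
have hZ (t : R) (y : C * C) :
    (row_rotZZ cR z t y).1 * ((row_rotZZ cR z t y).1^*)%R +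
    (row_rotZZ cR z t y).2 * ((row_rotZZ cR z t y).2^*)%R =
    y.1 * (y.1^*)%R + y.2 * (y.2^*)%R.
  have := tt (2 * t); rewrite rmorphD !rmorphXn rmorph1 /= => e.
  rewrite !(rmorphD, rmorphN, rmorphM, fmorphV) /= !conj_cR zJ invrK.
  by rewrite -[RHS]mul1r -e; ring: zV.
by rewrite hZ hX.
Qed.

End RowAlgebra.

(** * Homogeneous coordinates on the sphere *)

Section SphereCoordinates.
Variable R : realType.
Local Notation C := (Cplx R).

(* Homogeneous coordinates [P : Q] of a point of the sphere. *)
Definition represents (P Q : C) (s : sphere R) :=
  (Q != 0 /\ s = Some (P / Q)) \/ [/\ Q = 0, P != 0 & s = None].

Lemma represents_scale u P Q s : u != 0 ->
  represents P Q s -> represents (u * P) (u * Q) s.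
Proof.
move=> u0 [[Q0 ->]|[-> P0 ->]]; [left|right].
  split; first by rewrite mulf_neq0.
  by rewrite -mulf_div divff // mul1r.
by rewrite mulr0 mulf_neq0.
Qed.

(** The determinant condition keeps the two new coordinates from vanishing together, so they still
    define a point. *)
Lemma represents_moebius a b c d P Q s : a * d - b * c != 0 ->
  represents P Q s ->
  represents (a * P + b * Q) (c * P + d * Q) (moebius a b c d s).
Proof.
move=> det [[Q0 ->]|[-> P0 ->]] /=.
  have e1 : c * (P / Q) + d = (c * P + d * Q) / Q.
    by rewrite mulrDl mulfK // mulrA.
  have e2 : a * (P / Q) + b = (a * P + b * Q) / Q.
    by rewrite mulrDl mulfK // mulrA.
  rewrite e1 e2 mulf_eq0 invr_eq0 (negbTE Q0) orbF.
  case: eqVneq => h; [right|left].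
    split=> //; apply/eqP => h'; move: det; rewrite -(mulIr_eq0 _ (mulIf Q0)).
    have -> : (a * d - b * c) * Q = a * (c * P + d * Q) - c * (a * P + b * Q) by ring.
    by rewrite h h' !mulr0 subrr eqxx.
  split=> //; congr Some.
  by rewrite invf_div mulrA divfK.
rewrite !mulr0 !addr0; have [c0|c0] := eqVneq c 0; [right|left].
  rewrite c0 mul0r; split=> //; rewrite mulf_neq0 //.
  by apply: contra det => /eqP ->; rewrite c0 mul0r mulr0 subrr.
split; first by rewrite mulf_neq0.
by rewrite -mulf_div divff // mulr1.
Qed.

Definition sqnorm (z : C) : R := complex.Re z ^+ 2 + complex.Im z ^+ 2.

Lemma sqnormM x y : sqnorm (x * y) = sqnorm x * sqnorm y.
Proof. by case: x y => [a b] [c d]; rewrite /sqnorm /=; ring. Qed.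

Lemma sqnorm_eq0 x : (sqnorm x == 0) = (x == 0).
Proof.
case: x => a b; rewrite /sqnorm /= paddr_eq0 ?sqr_ge0 // !sqrf_eq0.
by rewrite eq_complex.
Qed.

Lemma weight_represents P Q s : represents P Q s ->
  weight s = sqnorm P / (sqnorm P + sqnorm Q).
Proof.
have wE z : weight (Some z) = sqnorm z / (1 + sqnorm z).
  have nz : complex.Re (`|z| : C) = Num.sqrt (sqnorm z) by case: z.
  by rewrite /weight nz sqr_sqrtr // addr_ge0 ?sqr_ge0.
move=> [[Q0 ->]|[-> P0 ->]].
  rewrite wE.
  have q0 : sqnorm Q != 0 by rewrite sqnorm_eq0.
  have q1 : 0 < sqnorm Q by rewrite lt0r q0 addr_ge0 ?sqr_ge0.
  have p1 : 0 <= sqnorm P by rewrite addr_ge0 ?sqr_ge0.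
  have -> : sqnorm P = sqnorm (P / Q) * sqnorm Q by rewrite -sqnormM divfK.
  have : 0 <= sqnorm (P / Q) by rewrite addr_ge0 ?sqr_ge0.
  move: (sqnorm (P / Q)) => r r0; field.
  by apply/andP; split; apply: lt0r_neq0; nra.
have -> : sqnorm 0 = 0 by apply/eqP; rewrite sqnorm_eq0.
by rewrite addr0 divff // sqnorm_eq0.
Qed.

End SphereCoordinates.

Section RowWeight.
Variables (R : realType).
Local Notation C := (Cplx R).

(** Half-angle formulas: e^{ik} + 1 = 2 cos(k/2) e^{ik/2} and e^{ik} - 1 = 2i sin(k/2) e^{ik/2}. *)
Lemma tan_cis (C' : numClosedFieldType) (r : {rmorphism R -> C'}) k : cos (k / 2) != 0 ->
  cis r k + 1 != 0 /\ 'i * r (tan (k / 2)) = (cis r k - 1) / (cis r k + 1).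
Proof.
move=> c0; have h2 : (2 : C') != 0 by rewrite pnatr_eq0.
have i2 : ('i * 'i : C') = -1 by rewrite -expr2 sqrCi.
have rc0 : r (cos (k / 2)) != 0 by rewrite fmorph_eq0.
have := congr1 r (cos2Dsin2 (k / 2)); rewrite rmorphD rmorph1 !rmorphXn /= => e.
have sE : r (sin (k / 2)) * r (sin (k / 2)) = 1 - r (cos (k / 2)) ^+ 2 by rewrite -e; ring.
have kE : cis r k = cis r (k / 2) * cis r (k / 2) by rewrite -cisD -splitr.
have e1 : cis r k + 1 = 2 * r (cos (k / 2)) * cis r (k / 2).
  by rewrite kE /cis; ring: i2 sE.
have e2 : cis r k - 1 = 2 * 'i * r (sin (k / 2)) * cis r (k / 2).
  by rewrite kE /cis; ring: i2 sE.
have h0 : cis r (k / 2) != 0.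
  by apply: contra_eq_neq (cis_mulN r (k / 2)) => ->; rewrite mul0r eq_sym oner_eq0.
rewrite e1 e2 /tan rmorphM fmorphV; split; first by rewrite !mulf_neq0.
by field; rewrite ?rc0 ?h0 ?h2.
Qed.

Lemma cis_neq0 (C' : numClosedFieldType) (r : {rmorphism R -> C'}) k : cis r k != 0.
Proof. by apply: contra_eq_neq (cis_mulN r k) => ->; rewrite mul0r eq_sym oner_eq0. Qed.

(** Up to a phase, this is the determinant of every Moebius step in the recursion. *)
Lemma cayley_det (F : fieldType) (z : F) : (2 : F) != 0 -> z + 1 != 0 -> z != 0 ->
  ((z - 1) / (z + 1)) ^+ 2 - 1 != 0.
Proof.
move=> h2 z1 z0; have -> : ((z - 1) / (z + 1)) ^+ 2 - 1 = - (2 * 2 * z) / (z + 1) ^+ 2.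
  by field.
by rewrite mulf_neq0 ?oppr_eq0 ?mulf_neq0 // invr_eq0 expf_neq0.
Qed.

Local Notation cr := (@cR R).

Lemma represents_f_iter gamma beta p k : cos (k / 2) != 0 ->
  let z := cis cr k in let x := row_iter cr gamma beta z p in
  represents (zzplus z x) (zzminus z x) (f_iter gamma beta p.*2 k).
Proof.
move=> c0 /=; set z := cis cr k.
have [z1 tE] := tan_cis cr c0; rewrite -/z in z1 tE.
have z0 : z != 0 by exact: cis_neq0.
have h2 : (2 : C) != 0 by rewrite pnatr_eq0.
have tauE : itan k = (z - 1) / (z + 1) :> C by rewrite -tE.
have det := cayley_det h2 z1 z0.
have e0 t : expi t != 0 :> C by exact: expi_neq0.
have eE t : expi t = cis cr t by rewrite expiE.
elim: p => [|p IH].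
  (* On the initial row [zzplus] is 0 and [zzminus] is -2i, in agreement with f_0 = 0. *)
  left; split; last first.
    by rewrite /zzplus /= mulrCA mulfV // !mulr1 addNr mul0r.
  rewrite /zzminus /= mulrCA mulfV // !mulr1 -opprD oppr_eq0 -mulr2n mulrn_eq0 /=.
  exact: neq0Ci.
rewrite doubleS; set x := row_iter _ _ _ _ _ in IH *.
have -> : f_iter gamma beta p.*2.+2 k =
   even_step (- 4 * beta`_p) k (odd_step (- 4 * gamma`_p) k (f_iter gamma beta p.*2 k)).
  by rewrite /= odd_double /= doubleK uphalf_double.
have -> : row_iter cr gamma beta z p.+1 =
   row_rotZZ cr z beta`_p (row_rotX cr gamma`_p x) by [].
set y := row_rotX _ _ _.
have hodd : represents (xminus y) (xplus y) (odd_step (- 4 * gamma`_p) k (f_iter gamma beta p.*2 k)).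
  have [u u0 [-> ->]] := odd_coords cr gamma`_p x z1 z0.
  apply: represents_scale => //; rewrite -eE -tauE; apply: represents_moebius IH.
  rewrite tauE mulr1 mulrNN -mulrA -expr2 -{2}[expi _]mulr1 -mulrBr.
  exact: mulf_neq0 (e0 _) det.
have [u u0 [-> ->]] := even_coords cr beta`_p y z1 z0.
apply: represents_scale => //; rewrite -eE -tauE; apply: represents_moebius hodd.
rewrite tauE mulr1 -mulrA -expr2 -{2}[expi _]mulr1 -mulrBr.
exact: mulf_neq0 (e0 _) det.
Qed.

Lemma represents_g_iter gamma beta p k : cos (k / 2) != 0 ->
  let x := row_iter cr gamma beta (cis cr k) p in
  represents (xminus x) (xplus x) (g_iter gamma beta p k).
Proof.
move=> c0 /=; have := represents_f_iter gamma beta p c0 => /=.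
have [z1 tE] := tan_cis cr c0.
have z0 : cis cr k != 0 by exact: cis_neq0.
have h2 : (2 : C) != 0 by rewrite pnatr_eq0.
have tauE : itan k = (cis cr k - 1) / (cis cr k + 1) :> C by rewrite -tE.
have det := cayley_det h2 z1 z0.
move: (row_iter _ _ _ _ _) => x hf.
have [u u0 [-> ->]] := final_coords x z1 z0.
apply: represents_scale => //; rewrite -tauE; apply: represents_moebius hf.
by rewrite tauE mulrNN mulr1 -expr2.
Qed.

(** With squared norm 2, |xminus|^2 = 2 - 2 Re(i conj(x.1) x.2), and |xminus|^2 + |xplus|^2 = 4 by
    the parallelogram identity. *)
Lemma row_weight gamma beta p k : cos (k / 2) != 0 ->
  let x := row_iter cr gamma beta (cis cr k) p in
  1 - 2 * weight (g_iter gamma beta p k) =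
    complex.Re ('i * ((x.1^*)%R * x.2) : C).
Proof.
move=> c0 /=; have := represents_g_iter gamma beta p c0 => /= /weight_represents ->.
have z0 : cis cr k != 0 by exact: cis_neq0.
have zJ : ((cis cr k)^*)%R = (cis cr k)^-1.
  have -> : cis cr k = expi k by rewrite expiE.
  by rewrite -expiN; exact: expi_conj.
have := row_iter_norm (@conj_real R) gamma beta p z0 zJ => /=.
move: (row_iter _ _ _ _ _) => [[a b] [c d]] /= /(congr1 (@complex.Re R)) /= e.
have -> : sqnorm (xminus (a +i* b, c +i* d)) = (a + d) ^+ 2 + (b - c) ^+ 2.
  by rewrite /xminus imagE /sqnorm /=; ring.
have -> : sqnorm (xplus (a +i* b, c +i* d)) = (a - d) ^+ 2 + (b + c) ^+ 2.
  by rewrite /xplus imagE /sqnorm /=; ring.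
have e' : a ^+ 2 + b ^+ 2 + c ^+ 2 + d ^+ 2 = 2 by rewrite -[RHS]e; ring.
have -> : (a + d) ^+ 2 + (b - c) ^+ 2 + ((a - d) ^+ 2 + (b + c) ^+ 2) = 4.
  by transitivity (2 * (a ^+ 2 + b ^+ 2 + c ^+ 2 + d ^+ 2)); [ring | rewrite e'; ring].
by transitivity (1 - ((a ^+ 2 + b ^+ 2 + c ^+ 2 + d ^+ 2) + 2 * (a * d - b * c)) / 2);
  [field | rewrite e'; field].
Qed.

End RowWeight.

(** * Integration over the momenta *)

Section TrigonometricIntegrals.
Variable R : realType.
Local Notation mu := (@lebesgue_measure R).
Implicit Types f g : R -> R.

Definition punctured : set (measurableTypeR R) := `]- pi, pi[ `\ 0.

Lemma measurable_punctured : measurable punctured.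
Proof. by apply: measurableD => //; exact: measurable_set1. Qed.

Definition has_integral f (v : R) :=
  mu.-integrable punctured (EFin \o f) /\ \int[mu]_(x in punctured) f x = v.

Lemma has_integralD f g v w : has_integral f v -> has_integral g w ->
  has_integral (fun x => f x + g x) (v + w).
Proof.
move=> [fi <-] [gi <-]; have mD := measurable_punctured; split.
  by have := integrableD mD fi gi.
by rewrite -RintegralD.
Qed.

Lemma has_integralZ f v (r : R) : has_integral f v -> has_integral (fun x => r * f x) (r * v).
Proof.
move=> [fi <-]; have mD := measurable_punctured; split.
  by have := integrableZl mD r fi.
by rewrite RintegralZl.
Qed.

Lemma has_integral_ext f g v : (forall x, punctured x -> f x = g x) ->
  has_integral f v -> has_integral g v.
Proof.
move=> fg [fi <-]; have mD := measurable_punctured; split.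
  by apply: eq_integrable fi => // x; rewrite inE => /fg /= ->.
by apply: eq_Rintegral => x; rewrite inE => /fg ->.
Qed.

Lemma has_integral_sum (I : Type) (r : seq I) (f : I -> R -> R) (v : I -> R) :
  (forall i, has_integral (f i) (v i)) ->
  has_integral (fun x => \sum_(i <- r) f i x) (\sum_(i <- r) v i).
Proof.
move=> fv; elim: r => [|i r IH].
  rewrite big_nil; apply: (@has_integral_ext (fun=> 0)).
    by move=> x _; rewrite big_nil.
  have mD := measurable_punctured.
  by split; [exact: integrable0 | rewrite /Rintegral integral0].
rewrite big_cons; apply: (@has_integral_ext (fun x => f i x + \sum_(j <- r) f j x)).
  by move=> x _; rewrite big_cons.
exact: has_integralD.
Qed.

(** The deleted point and the two ends are null sets, so the integral is the one over the closed
    interval. *)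
Lemma has_integral_FTC f (F : R -> R) :
    continuous f -> (forall x : R, is_derive x (1 : R) F (f x)) ->
  has_integral f (F pi - F (- pi)).
Proof.
move=> cf dF; have mD := measurable_punctured.
have pi2 : - pi < pi :> R by rewrite -subr_gt0 opprK addr_gt0 ?pi_gt0.
have fi : mu.-integrable `[- pi, pi] (EFin \o f).
  apply: continuous_compact_integrable; first exact: segment_compact.
  exact: continuous_subspaceT.
have fD (D : set (measurableTypeR R)) : measurable D -> D `<=` `[- pi, pi] -> mu.-integrable D (EFin \o f).
  by move=> mE sE; apply: integrableS fi.
have oc : (`]- pi, pi[ : set R) `<=` `[- pi, pi].
  by move=> x /=; rewrite !in_itv /= => /andP[/ltW -> /ltW ->].
have fD1 : mu.-integrable punctured (EFin \o f) by apply: fD => // x [/oc].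
split=> //; rewrite /Rintegral integral_setD1 //; last exact: (measurable_int mu).
rewrite -(@integral_itv_bndoo _ _ _ _ true false); last first.
  by apply: (measurable_int mu); exact: fD.
rewrite (@continuous_FTC2 _ f F) //.
- exact: continuous_subspaceT.
- have cF : continuous F.
    move=> x; apply: differentiable_continuous; apply/derivable1_diffP.
    exact: (@ex_derive _ _ _ _ _ _ _ (dF x)).
  split=> [x _||].
  + exact: (@ex_derive _ _ _ _ _ _ _ (dF x)).
  + exact/cvg_at_right_filter/cF.
  + exact/cvg_at_left_filter/cF.
- by move=> x _; rewrite derive1E; exact: (@derive_val _ _ _ _ _ _ _ (dF x)).
Qed.

Lemma has_integral_cst (c : R) : has_integral (fun=> c) (2 * pi * c).
Proof.
have -> : 2 * pi * c = c * pi - c * (- pi) :> R by ring.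
apply: (@has_integral_FTC _ (fun x => c * x)); first by move=> x; exact: cvg_cst.
move=> x; have := @is_deriveZ _ _ _ id c x 1 1 (is_derive_id _ _).
by rewrite /GRing.scale /= mulr1.
Qed.

Lemma sin_natpi n : sin (n%:R * pi) = 0 :> R.
Proof.
elim: n => [|n IH]; first by rewrite mul0r sin0.
by rewrite -natr1 mulrDl mul1r sinDpi IH oppr0.
Qed.

Lemma is_derive_scaled (f : R -> R) (s x d : R) :
  is_derive (s * x) (1 : R) f d -> is_derive x (1 : R) (fun y => f (s * y)) (s * d).
Proof.
move=> fd; have sd : is_derive x (1 : R) (fun y : R => s * y) s.
  by have := @is_deriveZ _ _ _ id s x 1 1 (is_derive_id _ _); rewrite /GRing.scale /= mulr1.
have := @is_derive1_comp _ f (fun y => s * y) x d s fd sd.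
by rewrite mulrC.
Qed.

(** For nonzero s the antiderivative is even, so its values at the two ends agree. *)
Lemma has_integral_sin (s : R) : has_integral (fun x => sin (s * x)) 0.
Proof.
have [->|s0] := eqVneq s 0.
  apply: (@has_integral_ext (fun=> 0)); first by move=> x _; rewrite mul0r sin0.
  by have := has_integral_cst 0; rewrite mulr0.
have -> : 0 = - s^-1 * cos (s * pi) - (- s^-1 * cos (s * (- pi))) :> R.
  by rewrite mulrN cosN subrr.
apply: (@has_integral_FTC _ (fun x => - s^-1 * cos (s * x))).
  move=> x; apply: continuous_comp; last exact: continuous_sin.
  by apply: cvgM; [exact: cvg_cst | exact: cvg_id].
move=> x; have d := is_derive_scaled (is_derive_cos (s * x)).
have := @is_deriveZ _ _ _ (fun x => cos (s * x)) (- s^-1) x 1 _ d.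
by rewrite /GRing.scale /= mulrN mulNr mulrN opprK mulrA mulVf // mul1r.
Qed.

Lemma has_integral_cos (m l : nat) :
  has_integral (fun x => cos ((m%:R - l%:R) * x)) (2 * pi * (m == l)%:R).
Proof.
have [->|ml] := eqVneq m l.
  apply: has_integral_ext (has_integral_cst 1) => x _.
  by rewrite subrr mul0r cos0.
set s : R := m%:R - l%:R.
have s0 : s != 0 by rewrite subr_eq0 eqr_nat.
have sp : sin (s * pi) = 0 by rewrite mulrBl sinB !sin_natpi mul0r mulr0 subrr.
have -> : 2 * pi * false%:R = s^-1 * sin (s * pi) - (s^-1 * sin (s * (- pi))) :> R.
  by rewrite mulrN sinN sp oppr0 !mulr0 subrr.
apply: (@has_integral_FTC _ (fun x => s^-1 * sin (s * x))).
  move=> x; apply: continuous_comp; last exact: continuous_cos.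
  by apply: cvgM; [exact: cvg_cst | exact: cvg_id].
move=> x; have d := is_derive_scaled (is_derive_sin (s * x)).
have := @is_deriveZ _ _ _ (fun x => sin (s * x)) (s^-1) x 1 _ d.
by rewrite /GRing.scale /= mulrA mulVf // mul1r.
Qed.

End TrigonometricIntegrals.

(** * Parseval's identity for finite sums *)

Section Parseval.
Variable R : realType.
Local Notation C := (Cplx R).
Local Notation cr := (@cR R).

Lemma ReD (x y : C) : complex.Re (x + y) = complex.Re x + complex.Re y.
Proof. by case: x y => [a b] [c d]. Qed.

Lemma Re_sum (I : Type) (r : seq I) (F : I -> C) :
  complex.Re (\sum_(i <- r) F i) = \sum_(i <- r) complex.Re (F i).
Proof. by elim: r => [|i r IH]; rewrite ?big_nil // !big_cons ReD IH. Qed.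

Lemma Re_mul_cis (c : C) t :
  complex.Re (c * cis cr t) = complex.Re c * cos t + - complex.Im c * sin t.
Proof.
have -> : cis cr t = expi t by rewrite expiE.
by case: c => a b /=; rewrite mulNr.
Qed.

Lemma cis_exp (D : numClosedFieldType) (r : {rmorphism R -> D}) k n :
  cis r k ^+ n = cis r (n%:R * k).
Proof.
elim: n => [|n IH]; first by rewrite expr0 mul0r cis0.
by rewrite exprSr IH -cisD -natr1 mulrDl mul1r.
Qed.

Lemma cis_conj (D : numClosedFieldType) (r : {rmorphism R -> D}) k :
  (forall y, (r y)^*%R = r y) -> (cis r k)^*%R = cis r (- k).
Proof.
move=> rJ; rewrite /cis cosN sinN !(rmorphD, rmorphM, rmorphN) /= conjCi !rJ.
by rewrite mulrN mulNr.
Qed.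

Lemma conj_pow_mul (D : numClosedFieldType) (r : {rmorphism R -> D}) k l m (a b : D) :
  (forall y, (r y)^*%R = r y) ->
  'i * ((cis r k ^+ l * a)^*%R * (cis r k ^+ m * b)) =
  'i * (a^*%R * b) * cis r ((m%:R - l%:R) * k).
Proof.
move=> rJ; rewrite rmorphM /= !cis_exp cis_conj // mulrBl addrC cisD; ring.
Qed.

(** The integrand is a double sum of cosines and sines of (m - l) k; only the cosines with m = l
    have a nonzero integral. *)
Lemma parseval N (alpha beta : nat -> C) :
  has_integral (fun k => complex.Re
     ('i * ((\sum_(l < N) cis cr k ^+ l * alpha l)^*%R *
            (\sum_(m < N) cis cr k ^+ m * beta m)) : C))
    (2 * pi * complex.Re ('i * (\sum_(l < N) (alpha l)^*%R * beta l) : C)).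
Proof.
pose c l m : C := 'i * ((alpha l)^*%R * beta m).
have -> : 2 * pi * complex.Re ('i * (\sum_(l < N) (alpha l)^*%R * beta l) : C) =
   \sum_(l < N) \sum_(m < N) (complex.Re (c l m) * (2 * pi * (m == l :> nat)%:R) + - complex.Im (c l m) * 0).
  rewrite mulr_sumr Re_sum mulr_sumr; apply: eq_bigr => l _.
  rewrite (bigD1 l) //= big1 ?addr0 => [|m ml]; last first.
    have /negbTE -> : (m : nat) != l by apply: contra ml => /eqP/val_inj ->.
    by rewrite !mulr0 addr0.
  by rewrite eqxx mulr1 mulr0 addr0 mulrC.
apply: (@has_integral_ext _ (fun k => \sum_(l < N) \sum_(m < N)
   (complex.Re (c l m) * cos ((m%:R - l%:R) * k) + - complex.Im (c l m) * sin ((m%:R - l%:R) * k)))).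
  move=> k _; rewrite rmorph_sum mulr_suml mulr_sumr Re_sum; apply: eq_bigr => l _.
  rewrite !mulr_sumr Re_sum; apply: eq_bigr => m _.
  by rewrite (conj_pow_mul _ _ _ _ _ (@conj_real R)) Re_mul_cis.
apply: has_integral_sum => l; apply: has_integral_sum => m.
apply: has_integralD; apply: has_integralZ; [exact: has_integral_cos | exact: has_integral_sin].
Qed.

End Parseval.

Section Magnetization.
Variable R : realType.
Local Notation C := (Cplx R).
Local Notation cr := (@cR R).

(** The site enters only through z^j, a phase that cancels between the two series when |z| = 1. *)
Lemma vac_series_unit (D : numClosedFieldType) (r : {rmorphism R -> D}) gamma beta p j N z :
    z != 0 -> (p < j)%N -> (j + p < N)%N ->
  let x := row_iter r gamma beta z p in
  \sum_(l < N) z ^+ l * vac_coef r (heis gamma beta p (unit_even R j)) l = z ^+ j * x.1 /\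
  \sum_(l < N) z ^+ l * vac_coef r (heis gamma beta p (unit_odd R j)) l = z ^+ j * x.2.
Proof.
move=> z0 pj jN /=.
rewrite (vac_series_heis r gamma beta z0 pj jN (@supported_even R j)).
rewrite (vac_series_heis r gamma beta z0 pj jN (@supported_odd R j)).
by rewrite !pairing_comb comb_even ?comb_odd //; lia.
Qed.

Lemma magnetization_bulk gamma beta p j N (j0 : 'I_N.+1) : (p < j)%N -> (j + p < N)%N ->
  expval (qaoa_state N.+1 gamma beta p) (at_site j0 (pauliX R)) =
  cr (1 - pi^-1 * \int[lebesgue_measure]_(k in `]- pi, pi[ `\ 0)
                     weight (g_iter gamma beta p k)).
Proof.
(* The given site may be next to the closing bond; it is moved to the bulk site j. *)
move=> pj jN; rewrite (expval_site_independent gamma beta p j0 (inord j)).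
have herm := expval_hermitian (qaoa_state N.+1 gamma beta p) (siteX_adj R N j).
rewrite -/(siteX R N j); move: herm; rewrite (expval_bulk gamma beta pj jN).
set S := \sum_(l < N) _ => herm.
have -> : 'i * S = cr (complex.Re ('i * S : C)).
  move: herm; case: ('i * S : C) => a b /= /(congr1 (@complex.Im R)) /= h.
  by rewrite /cR; congr (_ +i* _); lra.
congr cR.
have hF := parseval N (vac_coef cr (heis gamma beta p (unit_even R j)))
  (vac_coef cr (heis gamma beta p (unit_odd R j))).
rewrite -/S in hF; set v := complex.Re _ in hF *.
have hw : has_integral (fun k => weight (g_iter gamma beta p k)) (pi * (1 - v)).
  (* By [row_weight] the weight is 1/2 minus half of the Parseval integrand, whose integral is 2 pi
     v. *)
  have -> : pi * (1 - v) = 2 * pi * 2^-1 + - 2^-1 * (2 * pi * v) by field.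
  apply: has_integral_ext (has_integralD (has_integral_cst 2^-1) (has_integralZ (- 2^-1) hF)).
  move=> k [/=]; rewrite in_itv /= => /andP[k1 k2] _.
  have c0 : cos (k / 2) != 0.
    by apply: lt0r_neq0; apply: cos_gt0_pihalf; rewrite -mulNr !ltr_pM2r ?k1 ?k2 // invr_gt0.
  have [-> ->] := vac_series_unit cr gamma beta (cis_neq0 cr k) pj jN.
  rewrite (conj_pow_mul _ _ _ _ _ (@conj_real R)) subrr mul0r.
  by rewrite cis0 mulr1 -(row_weight gamma beta p c0); field.
rewrite (proj2 hw) mulKf ?lt0r_neq0 ?pi_gt0 //; ring.
Qed.

End Magnetization.

Theorem mainTheorem3 (R : realType) (p : nat) (hp : (0 < p)%N)
    (gamma beta : p.-tuple R) :
  (forall (L : nat), ~~ odd L -> forall j j' : 'I_L,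
     expval (qaoa_state L gamma beta p) (at_site j (pauliX R)) =
     expval (qaoa_state L gamma beta p) (at_site j' (pauliX R))) /\
  (forall j : (forall m : nat, 'I_(m.+1.*2)),
     (fun m : nat =>
        expval (qaoa_state m.+1.*2 gamma beta p)
          (at_site (j m) (pauliX R))) @ \oo -->
     ((1 - pi^-1 * \int[lebesgue_measure]_(k in `]- pi, pi[ `\ 0)
             weight (g_iter gamma beta p k))%:C : Cplx R)).
Proof.
split=> [L _ j j'|j]; first exact: expval_site_independent.
apply: cvg_near_cst; near=> m.
(* The ring has N + 1 = 2m + 2 sites; at the bulk site p + 1 the right margin reads 2p + 1 < 2m + 1,
   that is p < m. *)
apply: (@magnetization_bulk R gamma beta p p.+1 m.*2.+1 (j m)) => //.
have : (p < m)%N by near: m; exact: nbhs_infty_gt.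
lia.
Unshelve. all: by end_near. Qed.
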